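(* Consider the Cauchy problem in one space dimension $$(i\partial_t+\partial_x^4)u=\partial_x(\overline{u}^4),\quad (t,x)\in(0,\infty)\times\mathbb{R},\qquad u(0,x)=u_0(x).$$ Let $r>0$ be a constant with the following property: for every $T>0$ and every $u_0\in B_r(\dot H^{-1/2})$ there exists a solution $u\in\dot Z_r^{-1/2}([0,T))\subset C([0,T);\dot H^{-1/2})$ on $(0,T)$, this solution is unique in $\dot Z_r^{-1/2}([0,T))$, and the flow map $B_r(\dot H^{-1/2})\ni u_0\mapsto u\in\dot Z^{-1/2}([0,T))$ is Lipschitz continuous. Then for every $u_0\in B_r(\dot H^{-1/2})$ there exists a solution $u\in C([0,\infty);\dot H^{-1/2})$ of the problem on $(0,\infty)$, and the solution scatters in $\dot H^{-1/2}$: there exists $u^+\in\dot H^{-1/2}$ such that $$u(t)-e^{it\partial_x^4}u^+\to0\quad\text{in }\dot H^{-1/2}\text{ as }t\to+\infty.$$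
   Context: For a Banach space $H$ and $r>0$, $B_r(H):=\{f\in H:\|f\|_H\le r\}$. $L^2=L^2(\mathbb{R})$; functions are complex-valued; $\widehat{\cdot}$ is the spatial Fourier transform; $\dot H^s$ is the homogeneous $L^2$-based Sobolev space. Free evolution: $S(t)=e^{it\partial_x^4}$, i.e. $\widehat{S(t)f}(\xi)=e^{it|\xi|^4}\widehat f(\xi)$. A solution on $(0,T)$ ($0<T\le\infty$) with datum $u_0$ means a solution of $u(t)=S(t)u_0-i\int_0^tS(t-t')\partial_x(\overline{u(t')}^4)\,dt'$ for $0\le t<T$. Littlewood–Paley projections: $\chi\in C_0^\infty((-2,2))$ is even, non-negative, $\chi(t)=1$ for $|t|\le1$; $\psi(t)=\chi(t)-\chi(2t)$, $\psi_N(t)=\psi(N^{-1}t)$, and $\widehat{P_Nu}(\xi)=\psi_N(\xi)\widehat u(\xi)$ for $N\in2^{\mathbb{Z}}$. Sums $\sum_N$ run over $N\in 2^{\mathbb{Z}}$. $U^p$ spaces ($1\le p<\infty$): let $\mathcal Z$ be the set of finite partitions $\{t_k\}_{k=0}^K$, $K\in\mathbb{N}$, $-\infty<t_0<t_1<\dots<t_K\le\infty$. A $U^p$-atom is a function $a:\mathbb{R}\to L^2$, $a(t)=\sum_{k=1}^K\mathbf 1_{[t_{k-1},t_k)}(t)\phi_{k-1}$, with $\{t_k\}\in\mathcal Z$, $\phi_k\in L^2$, $\sum_{k=0}^{K-1}\|\phi_k\|_{L^2}^p=1$. $U^p$ is the space of $u=\sum_{j\ge1}\lambda_ja_j$ with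 $a_j$ $U^p$-atoms, $\lambda_j\in\mathbb{C}$, $\sum|\lambda_j|<\infty$, with norm the infimum of $\sum_j|\lambda_j|$ over all such representations. $U^p_S:=\{u:\mathbb{R}\to L^2: S(-\cdot)u\in U^p\}$ with $\|u\|_{U^p_S}:=\|S(-\cdot)u\|_{U^p}$. $\dot Z^s$ is the space of $u\in C(\mathbb{R};\dot H^s(\mathbb{R}))$ with $P_Nu\in U^2_S$ for every $N$ and $\|u\|_{\dot Z^s}:=\big(\sum_NN^{2s}\|P_Nu\|_{U^2_S}^2\big)^{1/2}<\infty$. For an interval $I$, $\dot Z^s(I)$ is the space of restrictions to $I$ of elements of $\dot Z^s$, with norm $\|u\|_{\dot Z^s(I)}=\inf\{\|\tilde u\|_{\dot Z^s}:\tilde u\in\dot Z^s,\ \tilde u|_I=u\}$. Finally $\dot Z^s_r(I):=\{u\in\dot Z^s(I):\|u\|_{\dot Z^s(I)}\le 2r\}$. *)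

(* Defs.v *)
From mathcomp Require Import all_boot all_order all_algebra complex.
From mathcomp Require Import all_classical all_reals all_analysis.

Set Implicit Arguments.
Unset Strict Implicit.
Unset Printing Implicit Defensive.
Import Order.TTheory GRing.Theory Num.Theory.
Import numFieldNormedType.Exports.

Local Open Scope classical_set_scope.
Local Open Scope ring_scope.
Local Open Scope complex_scope.

(* An element f of a homogeneous Sobolev space H^s (a tempered distribution
   whose Fourier transform is a function) is given by its Fourier transform
   g = f^ : R -> R[i], and equality in H^s is equality a.e. of the Fourier
   transforms.  So S(t), P_N and the H^s-norm, which are defined by conditions
   on f^, act on g.  Elements of L^2(R), on the other hand, are functions of
   the space variable, and so is the function u(t, x) whose conjugate is raised
   to the fourth power in the equation.  The Fourier transform is the unitary
   one, with kernel (2 pi)^(-1/2) e^(- i x xi). *)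

Section Fourier.
Variable R : realType.
Implicit Types (f g th : R -> R[i]) (s t : R).

Definition cmeasurable f : Prop :=
  measurable_fun setT (fun x => complex.Re (f x)) /\
  measurable_fun setT (fun x => complex.Im (f x)).

Definition cabs (z : R[i]) : R := Normc.normc z.

Definition cexp (t : R) : R[i] := cos t +i* sin t.

Definition cint (D : set R) f : R[i] :=
  (\int[lebesgue_measure]_(x in D) complex.Re (f x)) +i*
  (\int[lebesgue_measure]_(x in D) complex.Im (f x)).

Definition FT f (xi : R) : R[i] :=
  ((Num.sqrt (2 * pi))^-1)%:C * cint setT (fun x => cexp (- (x * xi)) * f x).

Definition IFT g (x : R) : R[i] :=
  ((Num.sqrt (2 * pi))^-1)%:C * cint setT (fun xi => cexp (x * xi) * g xi).

Definition L2norm f : \bar R :=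
  ('N[lebesgue_measure]_2%:E [(fun x => (cabs (f x))%:E)])%E.

Definition inL2 f : Prop := cmeasurable f /\ (L2norm f < +oo)%E.

Definition Hnorm s g : \bar R :=
  ('N[lebesgue_measure]_2%:E [(fun xi => (`|xi| `^ s * cabs (g xi))%:E)])%E.

(* For s < 1/2 such a g is locally integrable and of tempered growth, so that it
   is the Fourier transform of a tempered distribution. *)
Definition inH s g : Prop := cmeasurable g /\ (Hnorm s g < +oo)%E.

Definition Hball s (r : R) g : Prop := inH s g /\ (Hnorm s g <= r%:E)%E.

Definition Heq g1 g2 : Prop :=
  {ae lebesgue_measure, forall xi : R, g1 xi = g2 xi}.

Definition Hcontinuous s (I : set R) (u : R -> R -> R[i]) : Prop :=
  (forall t, I t -> inH s (u t)) /\
  (forall t0, I t0 ->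
     Hnorm s (u t \- u t0) @[t --> within I (nbhs t0)] --> 0%E).

Definition Sgroup t g : R -> R[i] := fun xi => cexp (t * `|xi| ^+ 4) * g xi.

Definition smooth (f : R -> R) : Prop :=
  forall n (x : R), derivable (derive1n n f) x 1.

Definition rschwartz (f : R -> R) : Prop :=
  smooth f /\
  forall m n : nat, exists C : R,
    forall x : R, `|x| ^+ m * `|derive1n n f x| <= C.

Definition schwartz th : Prop :=
  rschwartz (fun x => complex.Re (th x)) /\
  rschwartz (fun x => complex.Im (th x)).

End Fourier.

Section LittlewoodPaley.
Variable R : realType.
Implicit Types (chi : R -> R) (g : R -> R[i]).

Definition LPcutoff chi : Prop :=
  [/\ smooth chi,
      closure [set x : R | chi x != 0] `<=` `]-2, 2[,
      forall x, chi (- x) = chi x,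
      forall x, 0 <= chi x &
      forall x, `|x| <= 1 -> chi x = 1].

Definition dyadic (k : int) : R := 2 ^ k.

Definition LPpsi chi (x : R) : R := chi x - chi (2 * x).

Definition LPproj chi (N : R) g : R -> R[i] :=
  fun xi => (LPpsi chi (N^-1 * xi))%:C * g xi.

End LittlewoodPaley.

Section Up.
Variable R : realType.
Implicit Types (p : R) (u : R -> R -> R[i]).

(* The value at time s is sum_(k < K) 1_[t_k, t_(k+1))(s) phi_k; the times are
   extended reals because t_K may be +oo. *)
Definition Up_atom p (a : R -> R -> R[i]) : Prop :=
  exists (K : nat) (t : nat -> \bar R) (phi : nat -> R -> R[i]),
    [/\ (-oo < t 0%N)%E,
        forall k, (k < K)%N -> (t k < t k.+1)%E,
        forall k, (k < K)%N -> inL2 (phi k),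
        (\sum_(k < K) (L2norm (phi k) `^ p) = 1)%E &
        forall s x, a s x =
          \sum_(k < K) (if (t k <= s%:E < t k.+1)%E then phi k x else 0)].

(* An absolutely convergent series of atoms converges in L^2 at every time. *)
Definition Up_repr p u (lambda : nat -> R[i]) (a : nat -> R -> R -> R[i])
    : Prop :=
  [/\ forall j, Up_atom p (a j),
      (\sum_(0 <= j <oo) (cabs (lambda j))%:E < +oo)%E &
      forall t, L2norm (fun x => u t x - \sum_(j < n) lambda j * a j t x)
                  @[n --> \oo] --> 0%E].

Definition inUp p u : Prop :=
  (forall t, inL2 (u t)) /\ exists lambda a, Up_repr p u lambda a.

Definition Up_norm p u : \bar R :=
  ereal_inf [set M : \bar R | exists lambda a,
    Up_repr p u lambda a /\
    M = (\sum_(0 <= j <oo) (cabs (lambda j))%:E)%E].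

(* S(-t) v(t) as a function of the space variable, when v(t) is given by an
   integrable Fourier transform (for instance if v = P_N u). *)
Definition Sback (v : R -> R -> R[i]) : R -> R -> R[i] :=
  fun t => IFT (Sgroup (- t) (v t)).

Definition inUpS p (v : R -> R -> R[i]) : Prop := inUp p (Sback v).

Definition UpS_norm p (v : R -> R -> R[i]) : \bar R := Up_norm p (Sback v).

End Up.

Section Zspaces.
Variables (R : realType) (chi : R -> R).
Implicit Types (s : R) (I : set R) (u : R -> R -> R[i]).

Definition PN (k : int) u : R -> R -> R[i] :=
  fun t => LPproj chi (dyadic R k) (u t).

Definition Znorm s u : \bar R :=
  ((\esum_(k in [set: int])
      ((dyadic R k `^ (2 * s))%:E * UpS_norm 2 (PN k u) `^ 2)) `^ 2^-1)%E.

Definition inZ s u : Prop :=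
  [/\ Hcontinuous s setT u,
      forall k, inUpS 2 (PN k u) &
      (Znorm s u < +oo)%E].

(* A function on the interval I is given by a function on R of which only the
   values on I matter. *)
Definition Zextension s I u (v : R -> R -> R[i]) : Prop :=
  inZ s v /\ forall t, I t -> Heq (v t) (u t).

Definition inZon s I u : Prop :=
  (forall t, I t -> inH s (u t)) /\ exists v, Zextension s I u v.

Definition Znorm_on s I u : \bar R :=
  ereal_inf [set Znorm s v | v in [set v | Zextension s I u v]].

Definition inZball s (r : R) I u : Prop :=
  inZon s I u /\ (Znorm_on s I u <= (2 * r)%:E)%E.

End Zspaces.

Section Equation.
Variable R : realType.
Implicit Types (g th f : R -> R[i]) (u : R -> R -> R[i]) (T : \bar R).

Definition pairing g th : R[i] := cint setT (fun xi => g xi * th xi).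

(* Value at the Schwartz function th of the Fourier transform, in the sense of
   tempered distributions, of the function f. *)
Definition FTdist f th : R[i] := pairing f (FT th).

(* The distribution with Fourier transform g is the function f. *)
Definition represents g f : Prop :=
  forall th, schwartz th -> FTdist f th = pairing g th.

(* w(t, .) is the function u(t) for a.e. t, and its fourth power is integrable
   in time with values in the functions of tempered growth, so that the integral
   of S(t - t') d_x (conj(w(t'))^4) makes sense as a tempered distribution. *)
Definition space_time_function (T : R) u (w : R * R -> R[i]) : Prop :=
  [/\ measurable_fun (`]0, T[ `*` setT) (fun z : R * R => complex.Re (w z)),
      measurable_fun (`]0, T[ `*` setT) (fun z : R * R => complex.Im (w z)),
      exists m : nat,
        (\int[lebesgue_measure]_(t in `]0%R, T[)
           \int[lebesgue_measure]_(x in [set: R])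
             (cabs (w (t, x)) ^+ 4 / (1 + x ^+ 2) ^+ m)%:E < +oo)%E &
      {ae lebesgue_measure, forall t : R,
         0 < t < T -> represents (u t) (fun x => w (t, x))}].

(* Fourier transform, tested against th, of the Duhamel integral
   int_0^t S(t - t') d_x (conj(w(t'))^4) dt'; the multiplier
   i xi e^(i (t - t') |xi|^4) of S(t - t') d_x is moved to th. *)
Definition duhamel (w : R * R -> R[i]) (t : R) th : R[i] :=
  cint `[0, t] (fun t' =>
    FTdist (fun x => (w (t', x))^*%C ^+ 4)
           (fun xi => 'i%C * xi%:C * Sgroup (t - t') th xi)).

Definition solution_upto (T : R) (u0 : R -> R[i]) u : Prop :=
  exists w, space_time_function T u w /\
    forall t, 0 <= t <= T -> forall th, schwartz th ->
      pairing (u t) th = pairing (Sgroup t u0) th - 'i%C * duhamel w t th.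

Definition solution T (u0 : R -> R[i]) u : Prop :=
  forall T' : R, 0 < T' -> (T'%:E < T)%E -> solution_upto T' u0 u.

(* r is a radius for which the problem is well posed, for every T > 0, with data
   in the ball of radius r and solutions in Z_r^s([0, T)); the Lipschitz
   constant of the flow map may depend on T. *)
Definition wellposed_radius (chi : R -> R) (s r : R) : Prop :=
  forall T : R, 0 < T ->
  [/\ forall u0 : R -> R[i], Hball s r u0 ->
        exists u, inZball chi s r `[0, T[ u /\ solution T%:E u0 u,
      forall (u0 : R -> R[i]) u v, Hball s r u0 ->
        inZball chi s r `[0, T[ u -> solution T%:E u0 u ->
        inZball chi s r `[0, T[ v -> solution T%:E u0 v ->
        forall t, 0 <= t < T -> Heq (u t) (v t) &
      exists L : R, forall (u0 v0 : R -> R[i]) u v,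
        Hball s r u0 -> Hball s r v0 ->
        inZball chi s r `[0, T[ u -> solution T%:E u0 u ->
        inZball chi s r `[0, T[ v -> solution T%:E v0 v ->
        (Znorm_on chi s `[0%R, T[ (fun t => u t \- v t)%R
           <= L%:E * Hnorm s (u0 \- v0)%R)%E].

Definition scatters s u : Prop :=
  exists uplus, inH s uplus /\
    Hnorm s (u t \- Sgroup t uplus) @[t --> +oo] --> 0%E.

End Equation.

(* Main.v *)
Require Import Defs.
From HB Require Import structures.
From mathcomp Require Import all_boot all_order all_algebra complex.
From mathcomp Require Import all_classical all_reals all_analysis.
From mathcomp Require Import measurable_realfun.
From mathcomp Require Import ring lra.

(** By local well-posedness there is, for every n, a solution on [0, n) with norm
    at most 2r in Z([0, n)), and by uniqueness the solution on a longer interval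
    extends the one on a shorter interval, up to equality almost everywhere.
    They glue to a solution u on [0, oo), continuous because it agrees locally
    with elements of Z.  What remains is scattering: S(-t) u(t) has to converge
    in H^(-1/2) as t tends to infinity.  Two facts give it.

    - Every u|[0, n) has an extension to the whole line of Z-norm at most 3r, a
      bound that does not depend on n.  A U^2 function has finite quadratic
      variation, controlled by its norm ([up_variation]): an atom is a step
      function, whose increments telescope ([step_variation]), and the bound
      passes to absolutely convergent series of atoms.  Applied to S(-t) P_N u
      and summed over the dyadic blocks with weights 1/N, it bounds the sum over
      i of the squares of the H^(-1/2) norms of
      S(-t_(i+1)) u(t_(i+1)) - S(-t_i) u(t_i) by 48 (3r)^2, for every
      partition of [0, oo) ([Z_variation]).
    - A function on [0, oo) with finite quadratic variation is Cauchy at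
      infinity, since infinitely many disjoint increments of norm at least e would
      make the variation infinite ([cauchy_of_bounded_variation]); and a
      weighted L^2 space is complete ([limit_at_infinity]).  The limit is u^+,
      and as S(t) is an isometry of H^(-1/2), u(t) - S(t) u^+ tends to 0
      ([scatters_of_variation]).

    The U^2 norm is taken in the space variable and the H^(-1/2) norm in the
    frequency variable.  To pass from the first to the second one needs half of
    the Plancherel theorem: the L^2 norm of an integrable, square integrable g
    is at most that of its inverse Fourier transform ([plancherel_le]).  Its
    proof goes as follows.  For a real integrable a, let A be the integral over
    x >= 0 of the squared modulus of the integral of e^(i x xi) a(xi) d xi.
    Inserting the weight e^(-dx) cos(sx), which is at most 1, and using Fubini
    bounds the integral of a(xi) a(eta) p(xi - eta) by A, where p is a
    symmetrised Poisson kernel.  Integrating over |s| <= e and letting d tend to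
    0 replaces p by pi times the indicator of |xi - eta| < e, and A by 2e A
    ([box_energy]).  Adding the squares
    a(xi)^2 and a(eta)^2 makes the integrand nonnegative, so that as e tends to
    0 Fatou and the Lebesgue differentiation theorem give pi |a|^2 <= A
    ([plancherel_real_le]). *)

Import Order.TTheory GRing.Theory Num.Theory.
Import numFieldNormedType.Exports.

Local Open Scope classical_set_scope.
Local Open Scope ring_scope.
Local Open Scope complex_scope.

(** * Laplace transform of the cosine *)

Section Poisson.
Variable R : realType.
Local Notation mu := (@lebesgue_measure R).

Definition poisson (d t : R) : R := d / (d ^+ 2 + t ^+ 2).

Lemma derivable_continuous (f : R -> R) : (forall x, derivable f x 1) -> continuous f.
Proof. by move=> df x; apply: differentiable_continuous; apply/derivable1_diffP. Qed.

Lemma cvg_expRN (d : R) : 0 < d -> expR (- (d * x)) @[x --> +oo] --> (0:R).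
Proof.
move=> d0; apply: (@cvg_comp _ _ _ (fun x => d * x) (fun z => expR (- z)) _ (pinfty_nbhs R)).
  exact: gt0_cvgMry.
exact: cvgr_expR.
Qed.

Lemma integral_expR (d : R) : 0 < d ->
  (\int[mu]_(x in `[0%R, +oo[) (expR (- (d * x)))%:E = (d^-1)%:E)%E.
Proof.
move=> d0.
have D (x : R) : is_derive x 1 (fun x => - d^-1 * expR (- (d * x))) (expR (- (d * x))).
  apply: is_derive_eq; rewrite ?scaler0 ?addr0 ?add0r /GRing.scale/=.
  by field; rewrite gt_eqF.
rewrite (@ge0_continuous_FTC2y _ _ (fun x => - d^-1 * expR (- (d * x))) _ 0).
- by rewrite mulr0 oppr0 expR0 mulr1 EFinN oppeK add0e.
- by move=> x _; exact: expR_ge0.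
- apply: continuous_subspaceT; apply: derivable_continuous => x; exact: ex_derive.
- rewrite -[X in _ --> X](mulr0 (- d^-1)); apply: cvgMr; exact: cvg_expRN.
- by move=> x _; apply: ex_derive.
- apply: cvg_at_right_filter; apply: (derivable_continuous _ _ 0) => x; exact: ex_derive.
- by move=> x _; rewrite derive1E derive_val.
Qed.

(** Adding 1 to the cosine makes the integrand nonnegative, which is what the
    fundamental theorem of calculus on a half-line asks for; the integral of
    e^(-dx) is then subtracted. *)
Lemma integral_expR_cos (d t : R) : 0 < d ->
  (\int[mu]_(x in `[0%R, +oo[) (expR (- (d * x)) * cos (t * x))%:E
     = (poisson d t)%:E)%E.
Proof.
move=> d0.
have p0 : d ^+ 2 + t ^+ 2 != 0 by nra.
have ce : continuous (fun x : R => expR (- (d * x))).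
  by apply: derivable_continuous => x; exact: ex_derive.
have cc : continuous (fun x : R => expR (- (d * x)) * cos (t * x)).
  by apply: derivable_continuous => x; exact: ex_derive.
pose F := fun x : R => expR (- (d * x)) *
  ((d ^+ 2 + t ^+ 2)^-1 * (t * sin (t * x) - d * cos (t * x)) - d^-1).
have D (x : R) : is_derive x 1 F (expR (- (d * x)) * (1 + cos (t * x))).
  apply: is_derive_eq; rewrite ?scaler0 ?addr0 ?add0r /GRing.scale/=.
  by field; rewrite gt_eqF // p0.
have H : (\int[mu]_(x in `[0%R, +oo[) (expR (- (d * x)) * (1 + cos (t * x)))%:E
     = (poisson d t + d^-1)%:E)%E.
  rewrite (@ge0_continuous_FTC2y _ _ F _ 0).
  - rewrite /F /poisson !mulr0 oppr0 expR0 sin0 cos0 -EFinB; congr EFin.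
    by field; rewrite gt_eqF.
  - by move=> x _; rewrite mulr_ge0 ?expR_ge0 //=; have := cos_geN1 (t * x); lra.
  - apply: continuous_subspaceT; apply: derivable_continuous => x; exact: ex_derive.
  - apply/cvgr0Pnorm_le => e e0.
    pose M := `|(d ^+ 2 + t ^+ 2)^-1| * (`|t| + `|d|) + `|d^-1|.
    have M0 : 0 <= M by rewrite addr_ge0 // mulr_ge0 // addr_ge0.
    have /cvgr0Pnorm_le /(_ (e / (M + 1))) := cvg_expRN d d0.
    case; first by rewrite divr_gt0 // ltr_wpDl.
    move=> A [Ar HA]; exists A; split => // x Ax.
    rewrite normrM.
    apply: (@le_trans _ _ ((e / (M + 1)) * M)).
      apply: ler_pM => //; first exact: HA.
      rewrite /M (le_trans (ler_normB _ _)) // lerD2r normrM ler_wpM2l //.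
      rewrite (le_trans (ler_normB _ _)) // !normrM lerD // ler_piMr //.
        by rewrite ler_norml sin_geN1 sin_le1.
      by rewrite ler_norml cos_geN1 cos_le1.
    by rewrite mulrAC ler_pdivrMr ?ltr_wpDl // ler_wpM2l ?(ltW e0) // lerDl.
  - by move=> x _; apply: ex_derive.
  - apply: cvg_at_right_filter; apply: (derivable_continuous _ _ 0) => x; exact: ex_derive.
  - by move=> x _; rewrite derive1E derive_val.
have ie : mu.-integrable `[0%R, +oo[ (fun x => (expR (- (d * x)))%:E).
  apply/integrableP; split.
    by apply/measurable_EFinP; apply: measurable_funTS; exact: continuous_measurable_fun.
  under eq_integral do rewrite /= ger0_norm ?expR_ge0 //.
  by rewrite integral_expR // ltry.
have ic : mu.-integrable `[0%R, +oo[ (fun x => (expR (- (d * x)) * cos (t * x))%:E).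
  apply: le_integrable ie => //.
    by apply/measurable_EFinP; apply: measurable_funTS; exact: continuous_measurable_fun.
  move=> x _; rewrite lee_fin normrM ler_piMr //.
  by rewrite ler_norml cos_geN1 cos_le1.
move: H; under eq_integral do rewrite mulrDr mulr1 EFinD.
rewrite integralD // integral_expR // EFinD addeC.
by move=> /(congr1 (fun z => z - (d^-1)%:E)%E); rewrite !addeK.
Qed.

Lemma integrable_expR (d : R) : 0 < d ->
  mu.-integrable `[0%R, +oo[ (fun x => (expR (- (d * x)))%:E).
Proof.
move=> d0; apply/integrableP; split.
  apply/measurable_EFinP; apply: measurable_funTS; apply: continuous_measurable_fun.
  by apply: derivable_continuous => x; exact: ex_derive.
under eq_integral do rewrite /= ger0_norm ?expR_ge0 //.
by rewrite integral_expR // ltry.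
Qed.

End Poisson.

(** * Integrals over products *)

Section FubiniBounded.
Context d1 d2 (T1 : measurableType d1) (T2 : measurableType d2) (R : realType).
Variable m1 : {sigma_finite_measure set T1 -> \bar R}.
Variable m2 : {sigma_finite_measure set T2 -> \bar R}.

(** The form in which Fubini is applied below: a tensor product of integrable
    functions times a bounded kernel. *)
Lemma integrable_prod_bounded (w : T1 -> R) (A : T2 -> R) (k : T1 * T2 -> R) (M : R) :
  m1.-integrable setT (EFin \o w) -> m2.-integrable setT (EFin \o A) ->
  measurable_fun setT k -> (forall z, `|k z| <= M) ->
  (m1 \x m2)%E.-integrable setT (fun z => (w z.1 * A z.2 * k z)%:E).
Proof.
move=> iw iA mk kM.
have mw : measurable_fun setT w by apply/measurable_EFinP; apply: measurable_int iw.
have mA : measurable_fun setT A by apply/measurable_EFinP; apply: measurable_int iA.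
have iwA : (m1 \x m2)%E.-integrable setT (fun z => (w z.1 * A z.2)%:E).
  apply/(integrable12ltyP m1 m2).
    apply/measurable_EFinP; apply: measurable_funM.
      by apply: measurableT_comp.
    by apply: measurableT_comp.
  under eq_integral => x _.
    under eq_integral => y _ do rewrite /= normrM EFinM.
    rewrite ge0_integralZl //; last first.
      by apply: measurableT_comp => //; apply: measurableT_comp.
    over.
  rewrite ge0_integralZr //; last first.
  - by apply: integral_ge0.
  - by apply: measurableT_comp => //; apply: measurableT_comp.
  have /integrableP[_ w_lty] := iw; have /integrableP[_ A_lty] := iA.
  apply: lte_mul_pinfty; [exact: integral_ge0| |exact: A_lty].
  by rewrite ge0_fin_numE //; exact: integral_ge0.
apply: (@le_integrable _ _ _ _ _ _ _ (fun z => (M%:E * (w z.1 * A z.2)%:E)%E)) => //.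
- apply/measurable_EFinP; apply: measurable_funM => //.
  apply: measurable_funM.
    by apply: measurableT_comp.
  by apply: measurableT_comp.
- move=> z _; rewrite -EFinM lee_fin mulrC !normrM.
  by rewrite ler_wpM2r // (le_trans (kM z)) // ler_norm.
- exact: integrableZl.
Qed.

End FubiniBounded.

Arguments integrable_prod_bounded {d1 d2 T1 T2 R m1 m2} w A k M.
Arguments poisson {R} d t.
Arguments integrable_expR {R} d.

Section PlaneMeasure.
Variable R : realType.
Local Notation mu := (@lebesgue_measure R).

(** A name for the product, to which sigma-finiteness is attached so that the
    plane can in turn be a factor of a product. *)
Definition plane_measure := (mu \x mu)%E.

HB.instance Definition _ := Measure.on plane_measure.

Lemma plane_sigma_finite : sigma_finite setT plane_measure.
Proof.
exists (fun n => `[- n%:R, n%:R] `*` `[- n%:R, n%:R]).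
  apply/esym; rewrite -subTset => -[x y] _.
  exists (Num.truncn (Num.max `|x| `|y|)).+1 => //=.
  have := ltW (truncnS_gt (Num.max `|x| `|y|)).
  by rewrite ge_max => /andP[hx hy]; rewrite !in_itv/= -!ler_norml.
move=> n; split; first exact: measurableX.
rewrite /plane_measure product_measure1E //= lebesgue_measure_itv.
by case: ifP => _; rewrite ?mule0 // -EFinB -EFinM ltry.
Qed.

HB.instance Definition _ :=
  Measure_isSigmaFinite.Build _ _ _ plane_measure plane_sigma_finite.

Lemma plane_fubini (f : R * R -> R) :
  plane_measure.-integrable setT (EFin \o f) ->
  (\int[plane_measure]_z (f z)%:E = \int[mu]_x \int[mu]_y (f (x, y))%:E)%E.
Proof. by move=> fi; rewrite -(integral12_prod_meas1 fi). Qed.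

Lemma plane_tonelli (f : R * R -> R) : measurable_fun setT f ->
  (forall z, 0 <= f z) ->
  (\int[plane_measure]_z (f z)%:E = \int[mu]_x \int[mu]_y (f (x, y))%:E)%E.
Proof.
move=> mf f0; apply: (@fubini_tonelli1 _ _ _ _ R mu mu (EFin \o f)) => [|z].
  exact/measurable_EFinP.
by rewrite lee_fin.
Qed.

Lemma plane_tonelli2 (f : R * R -> R) : measurable_fun setT f ->
  (forall z, 0 <= f z) ->
  (\int[plane_measure]_z (f z)%:E = \int[mu]_y \int[mu]_x (f (x, y))%:E)%E.
Proof.
move=> mf f0; apply: (@fubini_tonelli2 _ _ _ _ R mu mu (EFin \o f)) => [|z].
  exact/measurable_EFinP.
by rewrite lee_fin.
Qed.

End PlaneMeasure.

Arguments plane_measure {R}.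

(** * Cosine and sine transforms of a real function *)

Section RealTransforms.
Variable R : realType.
Local Notation mu := (@lebesgue_measure R).
Local Notation nu := (@plane_measure R).

Lemma EFin_Rintegral d (T : measurableType d) (m : {measure set T -> \bar R})
    (D : set T) (f : T -> R) : measurable D -> m.-integrable D (EFin \o f) ->
  (\int[m]_(x in D) (f x)%:E)%E = (\int[m]_(x in D) f x)%:E.
Proof. by move=> mD fi; rewrite /Rintegral fineK // integrable_fin_num. Qed.

Lemma integral_patch_mul d (T : measurableType d) (m : {measure set T -> \bar R})
    (D : set T) (f g : T -> R) :
  (\int[m]_x ((f \_ D) x * g x)%:E = \int[m]_(x in D) (f x * g x)%:E)%E.
Proof.
rewrite [RHS]integral_mkcond; apply: eq_integral => x _; rewrite !patchE.
by case: ifP => // _; rewrite mul0r.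
Qed.

Lemma measurable_cos : measurable_fun setT (@cos R).
Proof. by apply: continuous_measurable_fun; exact: continuous_cos. Qed.

Lemma measurable_sin : measurable_fun setT (@sin R).
Proof. by apply: continuous_measurable_fun; exact: continuous_sin. Qed.

Lemma norm_cos_le1 (x : R) : `|cos x| <= 1.
Proof. by rewrite ler_norml cos_geN1 cos_le1. Qed.

Lemma norm_sin_le1 (x : R) : `|sin x| <= 1.
Proof. by rewrite ler_norml sin_geN1 sin_le1. Qed.

Variable a : R -> R.
Hypothesis ia : mu.-integrable setT (EFin \o a).

Lemma integrable_bounded_mul (k : R -> R) : measurable_fun setT k ->
  (forall x, `|k x| <= 1) -> mu.-integrable setT (fun x => (k x * a x)%:E).
Proof.
move=> mk k1; have ma : measurable_fun setT a.
  by apply/measurable_EFinP; apply: measurable_int ia.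
apply: le_integrable ia => //; first by apply/measurable_EFinP; exact: measurable_funM.
by move=> x _; rewrite lee_fin normrM ler_piMl.
Qed.

Definition cost (x : R) : R := \int[mu]_xi (cos (x * xi) * a xi).
Definition sint (x : R) : R := \int[mu]_xi (sin (x * xi) * a xi).

Lemma integrable_cost x : mu.-integrable setT (fun xi => (cos (x * xi) * a xi)%:E).
Proof.
apply: integrable_bounded_mul => [|xi]; last exact: norm_cos_le1.
by apply: measurableT_comp; [exact: measurable_cos|].
Qed.

Lemma integrable_sint x : mu.-integrable setT (fun xi => (sin (x * xi) * a xi)%:E).
Proof.
apply: integrable_bounded_mul => [|xi]; last exact: norm_sin_le1.
by apply: measurableT_comp; [exact: measurable_sin|].
Qed.

Lemma integral_cost x : (\int[mu]_xi (cos (x * xi) * a xi)%:E = (cost x)%:E)%E.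
Proof. by apply: EFin_Rintegral => //; exact: integrable_cost. Qed.

Lemma integral_sint x : (\int[mu]_xi (sin (x * xi) * a xi)%:E = (sint x)%:E)%E.
Proof. by apply: EFin_Rintegral => //; exact: integrable_sint. Qed.

Lemma cont_trig (c : R -> R) : continuous c -> (forall x, `|c x| <= 1) ->
  (forall x : R, mu.-integrable setT (fun xi => (c (x * xi) * a xi)%:E)) ->
  continuous (fun x : R => \int[mu]_xi (c (x * xi) * a xi)).
Proof.
move=> cc c1 ic x.
apply: (@continuity_under_integral R _ _ mu (fun x xi => c (x * xi) * a xi) setT
   measurableT (x - 1) (x + 1) _ _ (fun xi => `|a xi|)).
- by move=> y _; exact: ic.
- apply/nearW => xi _ y _; apply: cvgM; last exact: cvg_cst.
  apply: (@continuous_comp _ _ _ (fun l : R => l * xi) c); last exact: cc.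
  by apply: cvgM; [exact: cvg_id|exact: cvg_cst].
- exact: integrable_norm.
- by move=> y _; apply/nearW => xi _; rewrite normrM ler_piMl.
- by rewrite inE/= in_itv/= ltrBlDr !ltrDl ltr01.
Qed.

Lemma continuous_cost : continuous cost.
Proof.
by apply: cont_trig; [exact: continuous_cos|exact: norm_cos_le1|exact: integrable_cost].
Qed.

Lemma continuous_sint : continuous sint.
Proof.
by apply: cont_trig; [exact: continuous_sin|exact: norm_sin_le1|exact: integrable_sint].
Qed.

Lemma integrable_tensor (k : R * R -> R) (M : R) : measurable_fun setT k ->
  (forall z, `|k z| <= M) ->
  nu.-integrable setT (fun z => (a z.1 * a z.2 * k z)%:E).
Proof. by move=> mk kM; exact: (@integrable_prod_bounded _ _ _ _ R mu mu a a k M). Qed.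

Lemma measurable_sub12 : measurable_fun setT (fun z : R * R => z.1 - z.2).
Proof. by apply: measurable_funB; [exact: measurable_fst|exact: measurable_snd]. Qed.

(** The squared modulus at x of the unnormalised Fourier transform of a. *)
Definition power (x : R) : R := cost x ^+ 2 + sint x ^+ 2.

(** The transform times its conjugate is the double integral of
    a(xi) a(eta) e^(i x (xi - eta)); as it is real, only the cosine is left. *)
Lemma power_tensor x : ((power x)%:E =
  \int[nu]_z (a z.1 * a z.2 * cos (x * (z.1 - z.2)))%:E)%E.
Proof.
rewrite plane_fubini; last first.
  apply: (integrable_tensor _ 1) => [|z]; last exact: norm_cos_le1.
  apply: measurableT_comp; first exact: measurable_cos.
  by apply: measurable_funM => //; exact: measurable_sub12.
transitivity (\int[mu]_xi (cost x * (cos (x * xi) * a xi) +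
   sint x * (sin (x * xi) * a xi))%:E)%E; last first.
  apply: eq_integral => xi _.
  transitivity (\int[mu]_y ((a xi * cos (x * xi)) * (cos (x * y) * a y) +
      (a xi * sin (x * xi)) * (sin (x * y) * a y))%:E)%E; last first.
    by apply: eq_integral => y _; congr EFin; rewrite mulrBr cosB; ring.
  under eq_integral do rewrite EFinD !(EFinM (a xi * _)).
  rewrite integralD //; last 2 first.
  - by apply: integrableZl => //; exact: integrable_cost.
  - by apply: integrableZl => //; exact: integrable_sint.
  rewrite !integralZl //; last 2 first.
  - exact: integrable_sint.
  - exact: integrable_cost.
  by rewrite integral_cost integral_sint -!EFinM -EFinD; congr EFin; ring.
under eq_integral do rewrite EFinD (EFinM (cost x)) (EFinM (sint x)).
rewrite integralD //; last 2 first.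
- by apply: integrableZl => //; exact: integrable_cost.
- by apply: integrableZl => //; exact: integrable_sint.
rewrite !integralZl //; last 2 first.
- exact: integrable_sint.
- exact: integrable_cost.
by rewrite integral_cost integral_sint -!EFinM -EFinD /power !expr2.
Qed.

(** The cosine transform of e^(-dx) cos(sx).  The shift s is there to be averaged
    later over an interval, which turns the Poisson kernel into a box. *)
Definition poisson2 (d s t : R) : R := 2^-1 * (poisson d (t + s) + poisson d (t - s)).

Lemma integral_expR_coscos (d s t : R) : 0 < d ->
  (\int[mu]_(x in `[0%R, +oo[) (expR (- (d * x)) * cos (s * x) * cos (t * x))%:E
     = (poisson2 d s t)%:E)%E.
Proof.
move=> d0.
have ic u : mu.-integrable `[0, +oo[ (fun x => (expR (- (d * x)) * cos (u * x))%:E).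
  apply: le_integrable (integrable_expR d d0) => //.
    apply/measurable_EFinP; apply: measurable_funTS; apply: continuous_measurable_fun.
    by apply: derivable_continuous => x; exact: ex_derive.
  by move=> x _; rewrite lee_fin normrM ler_piMr // norm_cos_le1.
transitivity (\int[mu]_(x in `[0%R, +oo[) (2^-1%:E *
   ((expR (- (d * x)) * cos ((t + s) * x))%:E + (expR (- (d * x)) * cos ((t - s) * x))%:E)))%E.
  apply: eq_integral => x _; rewrite -EFinD -EFinM; congr EFin.
  by rewrite mulrDl mulrBl cosD cosB; field.
rewrite integralZl //; last exact: integrableD.
by rewrite integralD // !integral_expR_cos // -EFinD -EFinM.
Qed.

Lemma measurable_poisson2 d : 0 < d ->
  measurable_fun setT (fun z : R * R => poisson2 d z.1 z.2).
Proof.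
move=> d0.
have mp : measurable_fun setT (poisson d).
  apply: continuous_measurable_fun => x.
  apply: cvgMr; apply: cvgV; first by nra.
  by apply: (derivable_continuous _ (fun t : R => d ^+ 2 + t ^+ 2)) => y; exact: ex_derive.
apply: measurable_funM => //; apply: measurable_funD; apply: measurableT_comp => //.
  by apply: measurable_funD.
by apply: measurable_funB.
Qed.

Lemma poisson2_le d s t : 0 < d -> `|poisson2 d s t| <= d^-1.
Proof.
move=> d0.
have P u : 0 <= poisson d u <= d^-1.
  have q0 : 0 < d ^+ 2 + u ^+ 2 by rewrite ltr_pwDl ?sqr_ge0 ?exprn_gt0.
  rewrite /poisson divr_ge0 ?(ltW d0) ?(ltW q0) //= ler_pdivrMr // mulrDr expr2.
  by rewrite mulKf ?gt_eqF // lerDl mulr_ge0 ?sqr_ge0 // invr_ge0 ltW.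
have /andP[h1 h2] := P (t + s); have /andP[h3 h4] := P (t - s).
by rewrite ger0_norm /poisson2; lra.
Qed.

(** Fubini on the product of the half-line and the plane: integrating in x first
    yields the kernel, integrating over the plane first yields the power. *)
Lemma weighted_power d s : 0 < d ->
  (\int[nu]_z (a z.1 * a z.2 * poisson2 d s (z.1 - z.2))%:E
   = \int[mu]_(x in `[0%R, +oo[) (expR (- (d * x)) * cos (s * x) * power x)%:E)%E.
Proof.
move=> d0.
pose w := (fun x => expR (- (d * x))) \_ `[0, +oo[.
have iw : mu.-integrable setT (EFin \o w).
  have := integrable_expR d d0; rewrite integrable_mkcond //.
  by rewrite restrict_EFin.
(* [w] extends by 0 the weight, so that the integrals run over full spaces *)
pose F := fun p : R * (R * R) => (w p.1 * (a p.2.1 * a p.2.2) *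
  (cos (s * p.1) * cos (p.1 * (p.2.1 - p.2.2))))%:E.
have mF : measurable_fun setT (fun p : R * (R * R) => p.2.1 - p.2.2).
  by apply: (measurableT_comp measurable_sub12).
have iF : (mu \x nu)%E.-integrable setT F.
  apply: (@integrable_prod_bounded _ _ _ _ R mu nu w (fun z => a z.1 * a z.2)
    (fun p => cos (s * p.1) * cos (p.1 * (p.2.1 - p.2.2))) 1) => //.
  - rewrite (_ : _ \o _ = fun z => (a z.1 * a z.2 * 1)%:E); last first.
      by apply/funext => z /=; rewrite mulr1.
    by apply: (integrable_tensor (fun=> 1) 1) => // z; rewrite normr1.
  - apply: measurable_funM; apply: (measurableT_comp measurable_cos).
      by apply: measurable_funM.
    by apply: measurable_funM.
  - by move=> z; rewrite normrM mulr_ile1 // norm_cos_le1.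
have -> : (\int[mu]_(x in `[0%R, +oo[) (expR (- (d * x)) * cos (s * x) * power x)%:E
    = \int[mu]_x \int[nu]_z F (x, z))%E.
  under eq_integral do rewrite -mulrA.
  rewrite -integral_patch_mul; apply: eq_integral => x _; rewrite /F/=.
  under [RHS]eq_integral => z _.
    rewrite (_ : _ * _ * _ = w x * cos (s * x) * (a z.1 * a z.2 * cos (x * (z.1 - z.2))));
      last by ring.
    rewrite EFinM; over.
  rewrite integralZl //; first by rewrite -power_tensor -EFinM mulrA.
  apply: (integrable_tensor _ 1) => [|z]; last exact: norm_cos_le1.
  apply: (measurableT_comp measurable_cos).
  by apply: measurable_funM => //; exact: measurable_sub12.
rewrite (Fubini iF); apply: eq_integral => z _; rewrite /F/=.
transitivity (\int[mu]_x ((a z.1 * a z.2)%:E *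
    (w x * (cos (s * x) * cos (x * (z.1 - z.2))))%:E))%E; last first.
  by apply: eq_integral => x _; rewrite -EFinM; congr EFin; ring.
have E : (\int[mu]_x (w x * (cos (s * x) * cos (x * (z.1 - z.2))))%:E =
    (poisson2 d s (z.1 - z.2))%:E)%E.
  rewrite integral_patch_mul -integral_expR_coscos //.
  by apply: eq_integral => x _; rewrite mulrA (mulrC x).
rewrite integralZl //; first by rewrite E EFinM.
apply: le_integrable (iw) => //.
  apply/measurable_EFinP; apply: measurable_funM.
    by apply/measurable_EFinP; apply: measurable_int iw.
  apply: measurable_funM; apply: (measurableT_comp measurable_cos).
    exact: mulrl_measurable.
  exact: mulrr_measurable.
move=> x _; rewrite lee_fin [leLHS]normrM ler_piMr // normrM mulr_ile1 //.
all: exact: norm_cos_le1.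
Qed.

(** A half-line is enough: for real [a] the power is even. *)
Definition energy : \bar R := (\int[mu]_(x in `[0%R, +oo[) (power x)%:E)%E.

Lemma power_ge0 x : 0 <= power x.
Proof. by rewrite addr_ge0 // sqr_ge0. Qed.

Lemma measurable_power D : measurable_fun D power.
Proof.
apply: measurable_funTS; apply: measurable_funD; apply: measurable_funX.
  by apply: continuous_measurable_fun; exact: continuous_cost.
by apply: continuous_measurable_fun; exact: continuous_sint.
Qed.

(** The weight e^(-dx) cos(sx) is at most 1 in absolute value, so the bound is
    uniform in both parameters, and survives averaging in [s] and the limit
    of [d] to 0. *)
Lemma poisson2_energy d s : 0 < d ->
  (\int[nu]_z (a z.1 * a z.2 * poisson2 d s (z.1 - z.2))%:E <= energy)%E.
Proof.
move=> d0; rewrite weighted_power //.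
have me : measurable_fun setT (fun x : R => expR (- (d * x)) * cos (s * x)).
  apply: continuous_measurable_fun.
  by apply: derivable_continuous => x; exact: ex_derive.
apply: (le_trans (lee_abs _)); apply: (le_trans (le_abse_integral _ _ _)) => //.
  apply/measurable_EFinP; apply: measurable_funM; last exact: measurable_power.
  exact: measurable_funTS.
apply: ge0_le_integral => //.
- apply: measurableT_comp => //; apply/measurable_EFinP; apply: measurable_funM.
    exact: measurable_funTS.
  exact: measurable_power.
- by apply/measurable_EFinP; exact: measurable_power.
- move=> x; rewrite /= in_itv/= andbT => x0.
  rewrite lee_fin !normrM (ger0_norm (power_ge0 x)) ler_piMl ?power_ge0 //.
  rewrite mulr_ile1 // ?norm_cos_le1 // ger0_norm ?expR_ge0 //.
  by rewrite -expR0 ler_expR oppr_le0 mulr_ge0 // ltW.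
Qed.

End RealTransforms.

(** * Averages of the Poisson kernel *)

Section BoxAverage.
Variable R : realType.
Local Notation mu := (@lebesgue_measure R).
Local Notation nu := (@plane_measure R).

(** A smooth version of the indicator of |t| < e, to which it tends, up to a
    factor pi, as d tends to 0. *)
Definition atan_box (d e t : R) : R := atan ((t + e) / d) - atan ((t - e) / d).

Lemma integral_poisson2 (d e t : R) : 0 < d -> 0 < e ->
  (\int[mu]_(s in `[(- e)%R, e]) (poisson2 R d s t)%:E = (atan_box d e t)%:E)%E.
Proof.
move=> d0 e0.
pose F := fun s : R => 2^-1 * (atan ((t + s) * d^-1) - atan ((t - s) * d^-1)).
have p0 u : d ^+ 2 + u ^+ 2 != 0 by rewrite gt_eqF // ltr_pwDl ?sqr_ge0 ?exprn_gt0.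
have D (s : R) : is_derive s 1 F (poisson2 R d s t).
  apply: is_derive_eq; rewrite !scaler0 ?addr0 ?add0r ?subr0 /GRing.scale/=.
  rewrite /poisson2 /poisson; field; rewrite !p0 gt_eqF //.
have cF : continuous F by apply: derivable_continuous => x; exact: ex_derive.
have cp : continuous (fun s => poisson2 R d s t).
  have mp : continuous (@poisson R d).
    move=> x; apply: cvgMr; apply: cvgV; first exact: p0.
    by apply: (derivable_continuous _ (fun t : R => d ^+ 2 + t ^+ 2)) => y; exact: ex_derive.
  have c1 : continuous (fun s => poisson d (t + s)).
    move=> s; apply: (@continuous_comp _ _ _ (fun s : R => t + s)); last exact: mp.
    by apply: cvgD; [exact: cvg_cst|exact: cvg_id].
  have c2 : continuous (fun s => poisson d (t - s)).
    move=> s; apply: (@continuous_comp _ _ _ (fun s : R => t - s)); last exact: mp.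
    by apply: cvgB; [exact: cvg_cst|exact: cvg_id].
  by move=> s; apply: cvgMr; apply: cvgD; [exact: c1|exact: c2].
rewrite (@continuous_FTC2 _ _ F).
- rewrite -EFinB /F /atan_box opprK; congr EFin; by field.
- by rewrite gtrN.
- exact: continuous_subspaceT.
- split.
  + by move=> x _; exact: ex_derive.
  + by apply: cvg_at_right_filter; exact: cF.
  + by apply: cvg_at_left_filter; exact: cF.
- by move=> x _; rewrite derive1E derive_val.
Qed.

Lemma atan_box_cvg (e t : R) : atan_box n.+1%:R^-1 e t @[n --> \oo] -->
  pi / 2 * (Num.sg (t + e) - Num.sg (t - e)).
Proof.
have H (u : R) : atan (u / n.+1%:R^-1) @[n --> \oo] --> pi / 2 * Num.sg u.
  under eq_fun do rewrite invrK.
  have pos (v : R) : 0 < v -> atan (v * n.+1%:R) @[n --> \oo] --> pi / 2.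
    move=> v0; apply: (@cvg_comp _ _ _ (fun n => v * n.+1%:R) (@atan R) _ (pinfty_nbhs R)).
      apply/cvgryPge => A; near=> n; rewrite mulrC -ler_pdivrMr //.
      have : A / v <= n%:R by near: n; exact: nbhs_infty_ger.
      by move=> /le_trans; apply; rewrite ler_nat.
    exact: cvgy_atan.
  case: (ltgtP u 0) => [u0|u0|->].
  - rewrite ltr0_sg // mulrN1.
    rewrite (_ : (fun n => _) = fun n => - atan (- u * n.+1%:R)); last first.
      by apply/funext => n; rewrite mulNr atanN opprK.
    by apply: cvgN; apply: pos; rewrite oppr_gt0.
  - by rewrite gtr0_sg // mulr1; exact: pos.
  - by rewrite sgr0 mulr0; under eq_fun do rewrite mul0r atan0; exact: cvg_cst.
by rewrite mulrBr; apply: cvgB; exact: H.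
Unshelve. all: by end_near. Qed.

Lemma measurable_atan_box d e : measurable_fun setT (atan_box d e).
Proof.
apply: continuous_measurable_fun; apply: derivable_continuous => x; exact: ex_derive.
Qed.

Lemma atan_box_le d e t : `|atan_box d e t| <= pi.
Proof.
have H (u : R) : `|atan u| <= pi / 2.
  by rewrite ler_norml (ltW (atan_gtNpi2 u)) (ltW (atan_ltpi2 u)).
rewrite (le_trans (ler_normB _ _)) // (le_trans (lerD (H _) (H _))) //; lra.
Qed.

Variable a : R -> R.
Hypothesis ia : mu.-integrable setT (EFin \o a).

(** The integral over s in [-e, e] of the bound for the Poisson kernel; the
    factor 2e is the length of that interval. *)
Lemma atan_box_energy d e : 0 < d -> 0 < e ->
  (\int[nu]_z (a z.1 * a z.2 * atan_box d e (z.1 - z.2))%:E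
    <= (2 * e)%:E * energy R a)%E.
Proof.
move=> d0 e0.
have en0 : (0 <= energy R a)%E.
  by apply: integral_ge0 => x _; rewrite lee_fin power_ge0.
pose w := (cst 1 : R -> R) \_ `[- e, e].
have iw : mu.-integrable setT (EFin \o w).
  rewrite -restrict_EFin -integrable_mkcond //; apply/integrableP.
  split; first exact/measurable_EFinP.
  under eq_integral do rewrite /= normr1.
  rewrite integral_cst //= mul1e lebesgue_measure_itv/=; case: ifP => _ //.
  by rewrite -EFinB ltry.
pose F := fun p : R * (R * R) =>
  (w p.1 * (a p.2.1 * a p.2.2) * poisson2 R d p.1 (p.2.1 - p.2.2))%:E.
have iF : (mu \x nu)%E.-integrable setT F.
  apply: (@integrable_prod_bounded _ _ _ _ R mu nu w (fun z => a z.1 * a z.2)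
    (fun p => poisson2 R d p.1 (p.2.1 - p.2.2)) d^-1) => //.
  - rewrite (_ : _ \o _ = fun z => (a z.1 * a z.2 * 1)%:E); last first.
      by apply/funext => z /=; rewrite mulr1.
    by apply: (integrable_tensor R a ia (fun=> 1) 1) => // z; rewrite normr1.
  - apply: (@measurableT_comp _ _ _ _ _ _ (fun z : R * R => poisson2 R d z.1 z.2) _
      (fun p : R * (R * R) => (p.1, p.2.1 - p.2.2))).
      exact: measurable_poisson2.
    by apply: measurable_fun_pair => //; apply: (measurableT_comp (measurable_sub12 R)).
  - by move=> z; exact: poisson2_le.
have -> : (\int[nu]_z (a z.1 * a z.2 * atan_box d e (z.1 - z.2))%:E =
    \int[nu]_z \int[mu]_s F (s, z))%E.
  apply: eq_integral => z _; rewrite /F/=.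
  under [RHS]eq_integral do rewrite mulrAC mulrC EFinM.
  have E : (\int[mu]_s (w s * poisson2 R d s (z.1 - z.2))%:E =
    (atan_box d e (z.1 - z.2))%:E)%E.
    rewrite integral_patch_mul -integral_poisson2 //.
    by apply: eq_integral => s _; rewrite mul1r.
  rewrite integralZl //; first by rewrite E EFinM.
  apply: (@le_integrable _ _ _ mu _ measurableT _ (fun s => d^-1%:E * (w s)%:E)%E) => //.
  - apply/measurable_EFinP; apply: measurable_funM.
      by apply/measurable_EFinP; apply: measurable_int (iw).
    apply: (@measurableT_comp _ _ _ _ _ _ (fun z : R * R => poisson2 R d z.1 z.2) _
      (fun s : R => (s, z.1 - z.2))); first exact: measurable_poisson2.
    exact: measurable_fun_pair.
  - move=> s _; rewrite -EFinM lee_fin [leLHS]normrM [leRHS]normrM [leLHS]mulrC ler_wpM2r //.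
    by apply: (le_trans (poisson2_le _ _ _ _ d0)); exact: ler_norm.
  - exact: integrableZl.
rewrite -(Fubini iF).
have G s : (\int[nu]_z F (s, z) <= (w s)%:E * energy R a)%E.
  rewrite /F/= /w patchE; case: ifP => _ /=.
    under eq_integral do rewrite mul1r.
    by rewrite mul1e; exact: poisson2_energy.
  under eq_integral do rewrite !mul0r.
  by rewrite integral0 mul0e.
have wE : (\int[mu]_s (w s)%:E = (2 * e)%:E)%E.
  under eq_integral do rewrite -[w _]mulr1.
  rewrite integral_patch_mul.
  transitivity (\int[mu]_(x in `[(- e)%R, e]) (cst 1%:E x))%E.
    by apply: eq_integral => s _; rewrite mulr1.
  rewrite integral_cst //= mul1e lebesgue_measure_itv/= lte_fin gtrN //.
  by rewrite -EFinB; congr EFin; lra.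
case: (ltP (energy R a) +oo%E) => [fin|]; last first.
  by rewrite leye_eq => /eqP ->; rewrite gt0_muley ?leey // lte_fin mulr_gt0.
have fE : energy R a = (fine (energy R a))%:E by rewrite fineK // ge0_fin_numE.
rewrite -wE fE -integralZr //.
apply: le_integral => //.
- exact: (integrable_fubini_F iF).
- by apply: integrableZr.
- by move=> s _; rewrite -fE; exact: G.
Qed.

End BoxAverage.

(** * Lower limits of extended real sequences *)

Section LimitInferior.
Variable R : realType.
Implicit Types u : (\bar R)^nat.
Local Open Scope ereal_scope.

Lemma limn_einf_ge u c : (\forall n \near \oo, c <= u n) -> c <= limn_einf u.
Proof.
move=> [N _ cu]; rewrite limn_einf_lim; apply: lime_ge; first exact: is_cvg_einfs.
exists N => // n Nn; apply: le_ereal_inf_tmp => _ [m nm <-].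
by apply: cu; exact: leq_trans nm.
Qed.

Lemma limn_einf_le u c : (\forall n \near \oo, u n <= c) -> limn_einf u <= c.
Proof.
move=> uc; rewrite limn_einf_lim; apply: lime_le; first exact: is_cvg_einfs.
by apply: filterS uc => n un; apply: ge_ereal_inf; exists (u n) => //; exists n => /=.
Qed.

Lemma cvg0_near_lt (T : Type) (F : set_system T) (FF : Filter F) (f : T -> \bar R)
  (e : R) : (0 < e)%R -> f @ F --> 0 -> \forall x \near F, f x < e%:E.
Proof.
move=> e0 /fine_cvgP[ff] /cvgr_lt /(_ e e0) fe.
by near=> x; rewrite -[f x]fineK ?lte_fin; near: x.
Unshelve. all: by end_near. Qed.

(** A lower limit is minus the upper limit of the opposite sequence. *)
Lemma measurable_fun_limn_einf d (T : measurableType d) (f : (T -> \bar R)^nat) :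
  (forall n, measurable_fun setT (f n)) ->
  measurable_fun setT (fun x => limn_einf (f^~ x)).
Proof.
move=> mf; apply: measurableT_comp => //.
apply: (@measurable_fun_limn_esup _ _ _ setT (fun n x => - f n x)) => n.
exact: measurableT_comp.
Qed.

End LimitInferior.

(** * Half of the Plancherel theorem for real functions *)

Section LowerPlancherel.
Variable R : realType.
Local Notation mu := (@lebesgue_measure R).
Local Notation nu := (@plane_measure R).

(** The indicator of |t| < e, except for the value 1/2 at the endpoints.  In
    this form it is the pointwise limit of [atan_box] divided by pi. *)
Definition box (e t : R) : R := 2^-1 * (Num.sg (t + e) - Num.sg (t - e)).

Lemma box_in e t : `|t| < e -> box e t = 1.
Proof.
rewrite ltr_norml => /andP[h1 h2].
rewrite /box gtr0_sg ?ltr0_sg; [by lra|by rewrite subr_lt0|by rewrite -ltrBlDr sub0r].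
Qed.

Lemma box_out e t : 0 < e -> e < `|t| -> box e t = 0.
Proof.
move=> e0; rewrite ltr_normr /box => /orP[h|h].
  by rewrite !gtr0_sg ?subrr ?mulr0 //; lra.
by rewrite !ltr0_sg ?subrr ?mulr0 //; lra.
Qed.

Lemma box_itv e t : 0 < e -> 0 <= box e t <= 1.
Proof.
move=> e0; rewrite /box.
case: (ltgtP (t + e) 0) => h1; case: (ltgtP (t - e) 0) => h2;
  rewrite ?h1 ?h2 ?(gtr0_sg h1) ?(ltr0_sg h1) ?(gtr0_sg h2) ?(ltr0_sg h2) ?sgr0; lra.
Qed.

Lemma boxN e t : box e (- t) = box e t.
Proof.
rewrite /box (_ : - t + e = - (t - e)); last by ring.
by rewrite (_ : - t - e = - (t + e)) ?sgrN; ring.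
Qed.

Lemma measurable_box e : measurable_fun setT (box e).
Proof.
have cvgb (t : R) : setT t -> pi^-1 * atan_box R n.+1%:R^-1 e t @[n --> \oo] --> box e t.
  move=> _; have -> : box e t = pi^-1 * (pi / 2 * (Num.sg (t + e) - Num.sg (t - e))).
    rewrite /box; have := lt0r_neq0 (pi_gt0 R); move: (pi : R) => p p0; by field.
  by apply: cvgMr; exact: atan_box_cvg.
apply: (@measurable_fun_cvg _ _ R setT (fun n t => pi^-1 * atan_box R n.+1%:R^-1 e t)).
  by move=> n; apply: measurable_funM => //; exact: measurable_atan_box.
exact: cvgb.
Qed.

Variable a : R -> R.
Hypothesis ia : mu.-integrable setT (EFin \o a).

(** Dominated convergence, as d tends to 0, in the bound for [atan_box]. *)
Lemma box_energy e : 0 < e ->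
  (\int[nu]_z (a z.1 * a z.2 * (pi * box e (z.1 - z.2)))%:E
    <= (2 * e)%:E * energy R a)%E.
Proof.
move=> e0.
have mA : measurable_fun setT (fun z : R * R => (a z.1 * a z.2)).
  have ma : measurable_fun setT a by apply/measurable_EFinP; apply: measurable_int ia.
  by apply: measurable_funM; apply: (measurableT_comp ma).
have iA : nu.-integrable setT (fun z => `|(a z.1 * a z.2 * pi)%:E|%E).
  apply: integrable_abse.
  apply: (integrable_tensor R a ia (fun=> pi) pi) => // z.
  by rewrite ger0_norm // pi_ge0.
pose f := fun n (z : R * R) =>
  (a z.1 * a z.2 * atan_box R n.+1%:R^-1 e (z.1 - z.2))%:E.
pose g := fun z : R * R => (a z.1 * a z.2 * (pi * box e (z.1 - z.2)))%:E.
have mf n : measurable_fun setT (f n).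
  apply/measurable_EFinP; apply: measurable_funM => //.
  by apply: (measurableT_comp (measurable_atan_box R _ _)); exact: measurable_sub12.
have mg : measurable_fun setT g.
  apply/measurable_EFinP; apply: measurable_funM => //; apply: measurable_funM => //.
  by apply: (measurableT_comp (measurable_box _)); exact: measurable_sub12.
have fg : {ae nu, forall z, setT z -> f ^~ z @ \oo --> g z}.
  apply/nearW => z _; apply/cvg_EFin; first exact: nearW.
  apply: cvgMr; rewrite (_ : pi * _ = pi / 2 *
    (Num.sg (z.1 - z.2 + e) - Num.sg (z.1 - z.2 - e))); last by rewrite /box mulrA.
  exact: atan_box_cvg.
have fle : {ae nu, forall z n, setT z -> (`|f n z| <= `|(a z.1 * a z.2 * pi)%:E|)%E}.
  apply/nearW => z n _; rewrite lee_fin normrM [leRHS]normrM ler_wpM2l //.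
  by rewrite (ger0_norm (pi_ge0 _)) atan_box_le.
have [_ _ H] := @dominated_convergence _ _ R nu setT measurableT f g _ mf mg fg iA fle.
apply: (cvge_to_le H); apply: nearW => n; apply: atan_box_energy => //.
Qed.

Hypothesis ia2 : mu.-integrable setT (fun x => (a x ^+ 2)%:E).

Lemma measurable_base : measurable_fun setT a.
Proof. by apply/measurable_EFinP; apply: measurable_int ia. Qed.

Lemma integral_box e t : 0 < e ->
  (\int[mu]_s (box e (s - t))%:E <= (2 * e)%:E)%E.
Proof.
move=> e0.
have mb : measurable_fun setT (fun s : R => box e (s - t)).
  by apply: (measurableT_comp (measurable_box e)); apply: measurable_funB.
apply: (@le_trans _ _ (\int[mu]_s (\1_`[t - e, t + e] s)%:E)%E).
  apply: ge0_le_integral => //.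
  - by move=> s _; rewrite lee_fin; have /andP[] := box_itv e (s - t) e0.
  - exact/measurable_EFinP.
  - by apply/measurable_EFinP; exact: measurable_indic.
  - move=> s _; rewrite lee_fin indicE; case: (boolP (_ \in _)) => [_|].
      by have /andP[] := box_itv e (s - t) e0.
    rewrite notin_setE /= in_itv/= -ler_distl => /negP; rewrite -ltNge => h.
    by rewrite box_out.
rewrite integral_indic //= setIT lebesgue_measure_itv/= lte_fin.
rewrite ifT; last lra.
by rewrite -EFinB lee_fin; lra.
Qed.

Local Notation N := (\int[mu]_x (a x ^+ 2)%:E)%E.

Let msq : measurable_fun setT (fun x => a x ^+ 2).
Proof. by apply: measurable_funX; exact: measurable_base. Qed.

Lemma integral_sqr_ge0 : (0 <= N)%E.
Proof. by apply: integral_ge0 => x _; rewrite lee_fin sqr_ge0. Qed.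

Let N_lty : (N < +oo)%E.
Proof.
have /integrableP[_] := ia2; under eq_integral do rewrite /= ger0_norm ?sqr_ge0 //.
by [].
Qed.

Let mbox2 e : measurable_fun setT (fun z : R * R => box e (z.1 - z.2)).
Proof. by apply: (measurableT_comp (measurable_box e)); exact: measurable_sub12. Qed.

Lemma box_sqr_left e : 0 < e ->
  (\int[nu]_z (a z.1 ^+ 2 * box e (z.1 - z.2))%:E <= (2 * e)%:E * N)%E.
Proof.
move=> e0.
have b0 t : 0 <= box e t by have /andP[] := box_itv e t e0.
rewrite (plane_tonelli R (fun z => a z.1 ^+ 2 * box e (z.1 - z.2))); last 2 first.
- by apply: measurable_funM => //; apply: (measurableT_comp msq).
- by move=> z; rewrite mulr_ge0 // sqr_ge0.
rewrite -ge0_integralZl //=; last 3 first.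
- exact/measurable_EFinP.
- by move=> x _; rewrite lee_fin sqr_ge0.
- by rewrite lee_fin; lra.
apply: ge0_le_integral => //.
- by move=> x _; apply: integral_ge0 => y _; rewrite lee_fin mulr_ge0 // sqr_ge0.
- apply: (@measurable_fun_fubini_tonelli_F _ _ _ _ R mu
    (fun z : R * R => (a z.1 ^+ 2 * box e (z.1 - z.2))%:E)).
    apply/measurable_EFinP; apply: measurable_funM; last exact: mbox2.
    by apply: (measurableT_comp msq).
  by move=> z; rewrite /= lee_fin mulr_ge0 // sqr_ge0.
- by apply: measurable_funeM; exact/measurable_EFinP.
move=> x _; under eq_integral do rewrite EFinM.
rewrite ge0_integralZl //; last 3 first.
- by apply/measurable_EFinP; apply: (measurableT_comp (measurable_box e)); apply: measurable_funB.
- by move=> y _; rewrite lee_fin.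
- by rewrite lee_fin sqr_ge0.
rewrite muleC lee_wpmul2r ?lee_fin ?sqr_ge0 //.
under eq_integral => y _ do rewrite -boxN opprB.
exact: integral_box.
Qed.

Lemma box_sqr_right e : 0 < e ->
  (\int[nu]_z (a z.2 ^+ 2 * box e (z.1 - z.2))%:E <= (2 * e)%:E * N)%E.
Proof.
move=> e0.
have b0 t : 0 <= box e t by have /andP[] := box_itv e t e0.
rewrite (plane_tonelli2 R (fun z => a z.2 ^+ 2 * box e (z.1 - z.2))); last 2 first.
- by apply: measurable_funM => //; apply: (measurableT_comp msq).
- by move=> z; rewrite mulr_ge0 // sqr_ge0.
rewrite -ge0_integralZl //=; last 3 first.
- exact/measurable_EFinP.
- by move=> x _; rewrite lee_fin sqr_ge0.
- by rewrite lee_fin; lra.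
apply: ge0_le_integral => //.
- by move=> x _; apply: integral_ge0 => y _; rewrite lee_fin mulr_ge0 // sqr_ge0.
- apply: (@measurable_fun_fubini_tonelli_G _ _ _ _ R mu
    (fun z : R * R => (a z.2 ^+ 2 * box e (z.1 - z.2))%:E)).
    apply/measurable_EFinP; apply: measurable_funM; last exact: mbox2.
    by apply: (measurableT_comp msq).
  by move=> z; rewrite /= lee_fin mulr_ge0 // sqr_ge0.
- by apply: measurable_funeM; exact/measurable_EFinP.
move=> x _; under eq_integral do rewrite EFinM.
rewrite ge0_integralZl //; last 3 first.
- by apply/measurable_EFinP; apply: (measurableT_comp (measurable_box e)); apply: measurable_funB.
- by move=> y _; rewrite lee_fin.
- by rewrite lee_fin sqr_ge0.
rewrite muleC lee_wpmul2r ?lee_fin ?sqr_ge0 //.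
exact: integral_box.
Qed.

(** The cross term of (a(xi) + a(eta))^2 is controlled by the energy and the two
    squares by the L^2 norm.  Unlike the cross term alone, this integrand is
    nonnegative, so that Fatou will apply to it. *)
Lemma box_square e : 0 < e ->
  (\int[nu]_z ((a z.1 + a z.2) ^+ 2 * box e (z.1 - z.2))%:E
    <= (4 * e)%:E * N + (4 * e / pi)%:E * energy R a)%E.
Proof.
move=> e0.
have b0 t : 0 <= box e t by have /andP[] := box_itv e t e0.
have b1 t : `|pi * box e t| <= pi.
  rewrite normrM !ger0_norm ?pi_ge0 // ler_piMr ?pi_ge0 //.
  by have /andP[] := box_itv e t e0.
have i1 : nu.-integrable setT (fun z => (a z.1 ^+ 2 * box e (z.1 - z.2))%:E).
  apply/integrableP; split.
    apply/measurable_EFinP; apply: measurable_funM; last exact: mbox2.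
    by apply: (measurableT_comp msq).
  under eq_integral => z _.
    rewrite gee0_abs; last by rewrite lee_fin mulr_ge0 // sqr_ge0.
    over.
  by apply: (le_lt_trans (box_sqr_left e e0)); rewrite lte_mul_pinfty // lee_fin; lra.
have i2 : nu.-integrable setT (fun z => (a z.2 ^+ 2 * box e (z.1 - z.2))%:E).
  apply/integrableP; split.
    apply/measurable_EFinP; apply: measurable_funM; last exact: mbox2.
    by apply: (measurableT_comp msq).
  under eq_integral => z _.
    rewrite gee0_abs; last by rewrite lee_fin mulr_ge0 // sqr_ge0.
    over.
  by apply: (le_lt_trans (box_sqr_right e e0)); rewrite lte_mul_pinfty // lee_fin; lra.
have i3 : nu.-integrable setT (fun z => (a z.1 * a z.2 * (pi * box e (z.1 - z.2)))%:E).
  apply: (integrable_tensor R a ia (fun z => pi * box e (z.1 - z.2)) pi) => //.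
  exact: measurable_funM.
under eq_integral => z _.
  rewrite (_ : _ * _ = a z.1 ^+ 2 * box e (z.1 - z.2) + (a z.2 ^+ 2 * box e (z.1 - z.2)
     + 2 / pi * (a z.1 * a z.2 * (pi * box e (z.1 - z.2))))); last first.
    by have := lt0r_neq0 (pi_gt0 R); move: (pi : R) => p p0; field.
  rewrite EFinD EFinD (EFinM (2 / pi)).
  over.
rewrite integralD //; last by apply: integrableD => //; apply: integrableZl.
rewrite integralD //; last by apply: integrableZl.
rewrite integralZl //.
have p0 : 0 <= 2 / pi :> R by rewrite divr_ge0 // pi_ge0.
have -> : (4 * e)%:E = ((2 * e)%:E + (2 * e)%:E)%E by rewrite -EFinD; congr EFin; ring.
have -> : (4 * e / pi)%:E = ((2 / pi)%:E * (2 * e)%:E)%E by rewrite -EFinM; congr EFin; ring.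
rewrite ge0_muleDl ?lee_fin; [|lra|lra].
rewrite -[leRHS]addeA; apply: leeD; first  exact: box_sqr_left.
apply: leeD; first exact: box_sqr_right.
by rewrite -muleA lee_wpmul2l ?lee_fin //; exact: box_energy.
Qed.

(** As e tends to 0, this tends to (2 a(x))^2 for almost every x. *)
Definition box_avg e x : \bar R :=
  ((2 * e)^-1%:E * \int[mu]_y ((a x + a y) ^+ 2 * box e (x - y))%:E)%E.

Let b0 e t : 0 < e -> 0 <= box e t.
Proof. by move=> e0; have /andP[] := box_itv e t e0. Qed.

Let msum2 e : measurable_fun setT
  (fun z : R * R => (a z.1 + a z.2) ^+ 2 * box e (z.1 - z.2)).
Proof.
apply: measurable_funM; last exact: mbox2.
by apply: measurable_funX; apply: measurable_funD;
  apply: (measurableT_comp measurable_base).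
Qed.

Lemma box_avg_ge0 e x : 0 < e -> (0 <= box_avg e x)%E.
Proof.
move=> e0; rewrite mule_ge0 ?lee_fin ?invr_ge0 ?mulr_ge0 ?(ltW e0) //.
by apply: integral_ge0 => y _; rewrite lee_fin mulr_ge0 ?sqr_ge0 ?b0.
Qed.

Lemma measurable_box_avg e : 0 < e -> measurable_fun setT (box_avg e).
Proof.
move=> e0; apply: measurable_funeM.
apply: (@measurable_fun_fubini_tonelli_F _ _ _ _ R mu
    (fun z : R * R => ((a z.1 + a z.2) ^+ 2 * box e (z.1 - z.2))%:E)).
  by apply/measurable_EFinP; exact: msum2.
by move=> z; rewrite /= lee_fin mulr_ge0 ?b0 // sqr_ge0.
Qed.

Lemma integral_box_avg e : 0 < e ->
  (\int[mu]_x box_avg e x <= 2%:E * N + (2 / pi)%:E * energy R a)%E.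
Proof.
move=> e0; rewrite /box_avg ge0_integralZl //; last 3 first.
- apply: (@measurable_fun_fubini_tonelli_F _ _ _ _ R mu
    (fun z : R * R => ((a z.1 + a z.2) ^+ 2 * box e (z.1 - z.2))%:E)).
    by apply/measurable_EFinP; exact: msum2.
  by move=> z; rewrite /= lee_fin mulr_ge0 ?b0 // sqr_ge0.
- by move=> x _; apply: integral_ge0 => y _; rewrite lee_fin mulr_ge0 ?sqr_ge0 ?b0.
- by rewrite lee_fin invr_ge0; lra.
rewrite -(plane_tonelli R (fun z => (a z.1 + a z.2) ^+ 2 * box e (z.1 - z.2))); last 2 first.
- exact: msum2.
- by move=> z; rewrite mulr_ge0 ?b0 // sqr_ge0.
rewrite lee_pdivrMl; last lra.
rewrite ge0_muleDr; last 2 first.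
- by rewrite mule_ge0 // integral_sqr_ge0.
- rewrite mule_ge0 ?lee_fin ?divr_ge0 ?pi_ge0 //.
  by apply: integral_ge0 => x _; rewrite lee_fin power_ge0.
rewrite !muleA -!EFinM (_ : 2 * e * 2 = 4 * e); last by ring.
rewrite (_ : 2 * e * (2 / pi) = 4 * e / pi); last by ring.
exact: box_square.
Qed.

(** The last term tends to 0 with [e] at the Lebesgue points of [a].  For this
    only the first power of |a(y) - a(x)| may appear in it, whence the use of the
    pointwise inequality 4p^2 <= (p + q)^2 + 4|p||q - p|. *)
Lemma box_avg_davg e x : 0 < e ->
  ((4 * a x ^+ 2)%:E <= box_avg e x + (4 * `|a x|)%:E * davg a x e)%E.
Proof.
move=> e0.
have e20 : 0 < 2 * e by lra.
have mb : mu (ball x e) = (2 * e)%:E.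
  by rewrite lebesgue_measure_ball ?(ltW e0) // mulr2n -mulr_natl; congr EFin; ring.
have mdiff : measurable_fun (ball x e) (fun y => `|a y - a x|).
  apply: measurable_funTS; apply: measurableT_comp => //.
  by apply: measurable_funB => //; exact: measurable_base.
have msum : measurable_fun setT (fun y => (a x + a y) ^+ 2).
  by apply: measurable_funX; apply: measurable_funD => //; exact: measurable_base.
have mball : measurable (ball x e) by exact: measurable_ball.
rewrite /davg /iavg mb inver gt_eqF // /box_avg.
rewrite muleCA -ge0_muleDr; last 2 first.
- by apply: integral_ge0 => y _; rewrite lee_fin mulr_ge0 ?sqr_ge0 ?b0.
- by rewrite mule_ge0 ?lee_fin ?mulr_ge0 // integral_ge0.
rewrite lee_pdivlMl //.
apply: (@le_trans _ _ (\int[mu]_(y in ball x e) ((a x + a y) ^+ 2)%:E +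
   (4 * `|a x|)%:E * \int[mu]_(y in ball x e) (`|a y - a x|)%:E)%E); last first.
  rewrite leeD2r //.
  apply: (@le_trans _ _ (\int[mu]_(y in ball x e) ((a x + a y) ^+ 2 * box e (x - y))%:E)%E).
    apply: ge0_le_integral => //.
    - by move=> y _; rewrite lee_fin sqr_ge0.
    - by apply/measurable_EFinP; exact: measurable_funTS.
    - apply/measurable_EFinP; apply: measurable_funTS; apply: measurable_funM => //.
      by apply: (measurableT_comp (measurable_box e)); apply: measurable_funB.
    - by move=> y xy; rewrite box_in ?mulr1.
  apply: ge0_subset_integral => //.
  - apply/measurable_EFinP; apply: measurable_funM => //.
    by apply: (measurableT_comp (measurable_box e)); apply: measurable_funB.
  - by move=> y _; rewrite lee_fin mulr_ge0 ?sqr_ge0 ?b0.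
rewrite -ge0_integralZl //; last exact/measurable_EFinP.
rewrite -ge0_integralD //; last 3 first.
- by move=> y _; rewrite lee_fin sqr_ge0.
- by apply/measurable_EFinP; exact: measurable_funTS.
- by apply: measurable_funeM; exact/measurable_EFinP.
rewrite muleC -mb -integral_cst //.
apply: ge0_le_integral => //.
- by move=> y _; rewrite lee_fin mulr_ge0 // sqr_ge0.
- apply: emeasurable_funD.
    by apply/measurable_EFinP; exact: measurable_funTS.
  by apply: measurable_funeM; exact/measurable_EFinP.
- move=> y _; rewrite -EFinM -EFinD lee_fin -mulrA -normrM.
  have := ler_norm (- (a x * (a y - a x))); rewrite normrN.
  have := sqr_ge0 (a y - a x).
  move: `|_| => m; move: (a x) (a y) => p q; rewrite !expr2; nra.
Qed.

(** With N the integral of a^2 and E the energy, Fatou applied to [box_avg] as e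
    tends to 0 gives 4N <= 2N + (2/pi)E.  As N is finite, pi N <= E. *)
Theorem plancherel_real_le : (pi%:E * N <= energy R a)%E.
Proof.
have en0 : (0 <= energy R a)%E.
  by apply: integral_ge0 => x _; rewrite lee_fin power_ge0.
pose h n := box_avg n.+1%:R^-1.
have mh n : measurable_fun setT (h n) by apply: measurable_box_avg.
have h_ge0 n x : (0 <= h n x)%E by apply: box_avg_ge0.
(* [upper] is Fatou, [lower] is Lebesgue differentiation *)
have upper : (\int[mu]_x limn_einf (h^~ x) <= 2%:E * N + (2 / pi)%:E * energy R a)%E.
  apply: (le_trans (@fatou _ _ R mu setT measurableT h mh (fun n x _ => h_ge0 n x))).
  by apply: limn_einf_le; apply: nearW => n; exact: integral_box_avg.
have pointwise : {ae mu, forall x, setT x -> (4%:E * (a x ^+ 2)%:E <= limn_einf (h^~ x))%E}.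
  have lia : locally_integrable setT a.
    split; [exact: measurable_base|exact: openT|move=> K _ cK].
    have /integrableP[_] := ia; apply: le_lt_trans; apply: ge0_subset_integral => //.
      exact: compact_measurable.
    by apply/measurable_EFinP; apply: measurableT_comp => //; exact: measurable_base.
  apply: (@filterS _ _ (ae_filter_ringOfSetsType mu)) (lebesgue_differentiation lia) => x lpx _.
  have dx : davg a x n.+1%:R^-1 @[n --> \oo] --> 0%E.
    move/(cvge_at_rightP _ _ 0) : lpx => /(_ (fun n => n.+1%:R^-1)); apply; split => //.
    exact: cvg_harmonic.
  have /(cvgeZl (y := (4 * `|a x|)%:E) isT) := dx; rewrite mule0 => cx.
  apply/lee_addgt0Pr => e e0; rewrite -leeBlDr //; apply: limn_einf_ge.
  have small := cvg0_near_lt R _ _ _ _ e e0 cx.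
  near=> n.
  have /ltW dn : ((4 * `|a x|)%:E * davg a x n.+1%:R^-1 < e%:E)%E by near: n; exact: small.
  rewrite leeBlDr // -EFinM.
  have h0 : 0 < n.+1%:R^-1 :> R by rewrite invr_gt0.
  by apply: (le_trans (box_avg_davg _ x h0)); rewrite leeD2l.
have lower : (4%:E * N <= \int[mu]_x limn_einf (h^~ x))%E.
  rewrite -ge0_integralZl //; last 2 first.
  - exact/measurable_EFinP.
  - by move=> x _; rewrite lee_fin sqr_ge0.
  apply: ae_ge0_le_integral => //.
  - by move=> x _; rewrite mule_ge0 // lee_fin sqr_ge0.
  - by apply: measurable_funeM; exact/measurable_EFinP.
  - by move=> x _; apply: limn_einf_ge; exact: nearW.
  - exact: measurable_fun_limn_einf.
move: (le_trans lower upper) en0 integral_sqr_ge0 N_lty.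
case: (energy R a) => [E| |]; case: N => [M| |] //; rewrite ?leey //.
move=> + _ _ _; rewrite -!EFinM -EFinD !lee_fin.
have p0 := pi_gt0 R; move: (pi : R) p0 => p p0 H.
rewrite mulrC -ler_pdivlMr //; move: H; rewrite mulrAC; lra.
Unshelve. all: by end_near. Qed.

End LowerPlancherel.

(** * Weighted norms of complex functions *)

Section ComplexL2.
Variable R : realType.
Local Notation mu := (@lebesgue_measure R).
Implicit Types (f g : R -> R[i]) (w : R -> R) (z : R[i]) (t : R).

Definition sqn (z : R[i]) : R := complex.Re z ^+ 2 + complex.Im z ^+ 2.

Lemma sqn_ge0 z : 0 <= sqn z.
Proof. by rewrite addr_ge0 // sqr_ge0. Qed.

Lemma cabs_sqr z : cabs z ^+ 2 = sqn z.
Proof. by case: z => p q; rewrite /cabs /= sqr_sqrtr // addr_ge0 // sqr_ge0. Qed.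

Lemma cabs_ge0 z : 0 <= cabs z.
Proof. by case: z => p q; rewrite /cabs /= sqrtr_ge0. Qed.

Lemma sqnM (z1 z2 : R[i]) : sqn (z1 * z2) = sqn z1 * sqn z2.
Proof. by case: z1 => p q; case: z2 => p' q'; rewrite /sqn /=; ring. Qed.

Lemma sqn_cexp t : sqn (cexp t) = 1.
Proof. by rewrite /sqn /= cos2Dsin2. Qed.

Lemma sqnN z : sqn (- z) = sqn z.
Proof. by case: z => p q; rewrite /sqn /= !sqrrN. Qed.

Lemma sqn_real (x : R) : sqn x%:C = x ^+ 2.
Proof. by rewrite /sqn /= expr0n addr0. Qed.

(** The square of the weighted L^2 norm.  Quadratic variations are sums of squared
    norms, and the squares add up under the integral. *)
Definition wnorm2 w g : \bar R := (\int[mu]_x (w x * sqn (g x))%:E)%E.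

(** The weight of H^s as it stands under the integral of the squared norm. *)
Definition hweight (s xi : R) : R := (`|xi| `^ s) ^+ 2.

Lemma hweight_ge0 s xi : 0 <= hweight s xi.
Proof. exact: sqr_ge0. Qed.

Lemma L2norm_sqr f : (L2norm f `^ 2 = wnorm2 (cst 1%R) f)%E.
Proof.
rewrite /L2norm poweR_Lnorm //; apply: eq_integral => x _.
by rewrite gee0_abs ?lee_fin ?cabs_ge0 // poweR_EFin powR_mulrn ?cabs_ge0 // cabs_sqr mul1r.
Qed.

Lemma Hnorm_sqr s g : (Hnorm s g `^ 2 = wnorm2 (hweight s) g)%E.
Proof.
rewrite /Hnorm poweR_Lnorm //; apply: eq_integral => x _.
have h : 0 <= `|x| `^ s * cabs (g x) by rewrite mulr_ge0 ?powR_ge0 ?cabs_ge0.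
by rewrite gee0_abs ?lee_fin // poweR_EFin powR_mulrn // exprMn cabs_sqr.
Qed.

Lemma L2norm_ge0 f : (0 <= L2norm f)%E. Proof. exact: Lnorm_ge0. Qed.
Lemma Hnorm_ge0 s g : (0 <= Hnorm s g)%E. Proof. exact: Lnorm_ge0. Qed.

Lemma wnorm2_ge0 w g : (forall x, 0 <= w x) -> (0 <= wnorm2 w g)%E.
Proof. by move=> w0; apply: integral_ge0 => x _; rewrite lee_fin mulr_ge0 ?sqn_ge0. Qed.

Lemma cmeasurable_sqn g : cmeasurable g -> measurable_fun setT (fun x => sqn (g x)).
Proof. by move=> [m1 m2]; apply: measurable_funD; apply: measurable_funX. Qed.

Lemma measurable_wsqn w g : measurable_fun setT w -> cmeasurable g ->
  measurable_fun setT (fun x => (w x * sqn (g x))%:E).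
Proof.
by move=> mw mg; apply/measurable_EFinP; apply: measurable_funM => //; exact: cmeasurable_sqn.
Qed.

Lemma cmeasurableD f g : cmeasurable f -> cmeasurable g ->
  cmeasurable (fun x => f x + g x).
Proof.
move=> [f1 f2] [g1 g2]; split.
  rewrite (_ : (fun x => _) = (fun x => complex.Re (f x) + complex.Re (g x))).
    exact: measurable_funD.
  by apply/funext => x; case: (f x); case: (g x).
rewrite (_ : (fun x => _) = (fun x => complex.Im (f x) + complex.Im (g x))).
  exact: measurable_funD.
by apply/funext => x; case: (f x); case: (g x).
Qed.

Lemma cmeasurableM f g : cmeasurable f -> cmeasurable g ->
  cmeasurable (fun x => f x * g x).
Proof.
move=> [f1 f2] [g1 g2]; split.
  rewrite (_ : (fun x => _) = (fun x => complex.Re (f x) * complex.Re (g x)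
    - complex.Im (f x) * complex.Im (g x))).
    by apply: measurable_funB; apply: measurable_funM.
  by apply/funext => x; case: (f x); case: (g x).
rewrite (_ : (fun x => _) = (fun x => complex.Re (f x) * complex.Im (g x)
    + complex.Im (f x) * complex.Re (g x))).
  by apply: measurable_funD; apply: measurable_funM.
by apply/funext => x; case: (f x) => a b; case: (g x) => c d /=; ring.
Qed.

Lemma cmeasurableN f : cmeasurable f -> cmeasurable (fun x => - f x).
Proof.
move=> [f1 f2]; split.
  rewrite (_ : (fun x => _) = (fun x => - complex.Re (f x))); first exact: measurable_funN.
  by apply/funext => x; case: (f x).
rewrite (_ : (fun x => _) = (fun x => - complex.Im (f x))); first exact: measurable_funN.
by apply/funext => x; case: (f x).
Qed.

Lemma cmeasurableB f g : cmeasurable f -> cmeasurable g ->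
  cmeasurable (fun x => f x - g x).
Proof. by move=> mf mg; apply: cmeasurableD => //; exact: cmeasurableN. Qed.

Lemma cmeasurable_cst z : cmeasurable (fun=> z).
Proof. by split. Qed.

Lemma cmeasurable_real w : measurable_fun setT w -> cmeasurable (fun x => (w x)%:C).
Proof. by split. Qed.

Lemma cmeasurable_cexp w : measurable_fun setT w -> cmeasurable (fun x => cexp (w x)).
Proof.
by move=> mw; split; [apply: (measurableT_comp (measurable_cos R))
  |apply: (measurableT_comp (measurable_sin R))].
Qed.

Lemma cmeasurable_sum (I : Type) (r : seq I) (F : I -> R -> R[i]) :
  (forall i, cmeasurable (F i)) -> cmeasurable (fun x => \sum_(i <- r) F i x).
Proof.
move=> mF; elim: r => [|i r IH].
  rewrite (_ : (fun x => _) = fun=> 0); first exact: cmeasurable_cst.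
  by apply/funext => x; rewrite big_nil.
rewrite (_ : (fun x => _) = fun x => F i x + \sum_(j <- r) F j x).
  exact: cmeasurableD.
by apply/funext => x; rewrite big_cons.
Qed.

(** Split the line at 0 and reflect the negative half. *)
Lemma integral_fold (f : R -> \bar R) : measurable_fun setT f -> (forall x, (0 <= f x)%E) ->
  (\int[mu]_x f x = \int[mu]_(x in `[0%R, +oo[) (f x + f (- x)%R))%E.
Proof.
move=> mf f0.
have mfN : measurable_fun setT (fun x : R => f (- x)) by exact: measurableT_comp.
rewrite ge0_integralD //; [|exact: measurable_funTS|exact: measurable_funTS].
rewrite (ge0_integration_by_substitution0 mfN) //.
under [X in (_ = _ + X)%E]eq_integral do rewrite opprK.
rewrite -(setUv (`[0%R, +oo[%classic : set R)) ge0_integral_setU//= ; last 3 first.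
- exact: measurableC.
- by rewrite setUv.
- exact/disj_setPCl.
by rewrite setCitvr integral_itv_bndo_bndc //; exact: measurable_funTS.
Qed.

(** * Half of the Plancherel theorem *)

Section Plancherel.
Variable g : R -> R[i].
Local Notation a := (fun x => complex.Re (g x)).
Local Notation b := (fun x => complex.Im (g x)).
Hypothesis ia : mu.-integrable setT (fun x => (a x)%:E).
Hypothesis ib : mu.-integrable setT (fun x => (b x)%:E).

Lemma IFT_transforms x : IFT g x = ((Num.sqrt (2 * pi))^-1)%:C *
  ((cost R a x - sint R b x) +i* (cost R b x + sint R a x)).
Proof.
rewrite /IFT /cint; congr (_ * (_ +i* _)).
  rewrite (_ : (fun x => _) = (fun xi => cos (x * xi) * a xi - sin (x * xi) * b xi)).
    by rewrite RintegralB //; [exact: integrable_cost|exact: integrable_sint].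
  by apply/funext => xi; case: (g xi).
rewrite (_ : (fun x => _) = (fun xi => cos (x * xi) * b xi + sin (x * xi) * a xi)).
  by rewrite RintegralD //; [exact: integrable_cost|exact: integrable_sint].
by apply/funext => xi; case: (g xi).
Qed.

Lemma costN (h : R -> R) x : cost R h (- x) = cost R h x.
Proof. by congr Rintegral; apply/funext => xi; rewrite mulNr cosN. Qed.

Lemma sintN (h : R -> R) x : mu.-integrable setT (fun x => (h x)%:E) ->
  sint R h (- x) = - sint R h x.
Proof.
move=> ih; rewrite /sint -[RHS]mulN1r -RintegralZl //; last exact: integrable_sint.
by congr Rintegral; apply/funext => xi; rewrite mulNr sinN mulN1r mulNr.
Qed.

(** For g = a + ib the cross terms between the transforms of [a] and of [b] are
    odd in [x]: only the powers of [a] and [b] survive in the sum of the values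
    at [x] and [-x]. *)
Lemma IFT_sqn_fold x : sqn (IFT g x) + sqn (IFT g (- x)) =
  pi^-1 * (power R a x + power R b x).
Proof.
rewrite !IFT_transforms !sqnM sqn_real !costN !sintN // /sqn /power /= exprVn sqr_sqrtr; last first.
  by rewrite mulr_ge0 // pi_ge0.
by have := lt0r_neq0 (pi_gt0 R); move: (pi : R) => p p0; field.
Qed.

Lemma cmeasurable_IFT : cmeasurable (IFT g).
Proof.
rewrite (_ : IFT g = fun x => ((Num.sqrt (2 * pi))^-1)%:C *
  ((cost R a x - sint R b x) +i* (cost R b x + sint R a x))); last first.
  by apply/funext => x; exact: IFT_transforms.
apply: cmeasurableM; first exact: cmeasurable_cst.
have mc h : mu.-integrable setT (fun x => (h x)%:E) -> measurable_fun setT (cost R h).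
  by move=> ih; apply: continuous_measurable_fun; exact: continuous_cost.
have ms h : mu.-integrable setT (fun x => (h x)%:E) -> measurable_fun setT (sint R h).
  by move=> ih; apply: continuous_measurable_fun; exact: continuous_sint.
by split; [apply: measurable_funB; [exact: mc|exact: ms]|
  apply: measurable_funD; [exact: mc|exact: ms]].
Qed.

Hypothesis ga2 : (wnorm2 (cst 1%R) g < +oo)%E.

(** Folding the line onto a half-line decouples the real and the imaginary part
    of [g], and the inequality for real functions applies to each. *)
Theorem plancherel_le : (wnorm2 (cst 1%R) g <= wnorm2 (cst 1%R) (IFT g))%E.
Proof.
have mg : cmeasurable g.
  by split; apply/measurable_EFinP; [exact: measurable_int ia|exact: measurable_int ib].
have mG := cmeasurable_IFT.
rewrite /wnorm2 [leRHS]integral_fold; last 2 first.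
- by apply: measurable_wsqn.
- by move=> x; rewrite lee_fin mul1r sqn_ge0.
under [leRHS]eq_integral do rewrite -EFinD !mul1r IFT_sqn_fold EFinM.
rewrite ge0_integralZl //; last 3 first.
- by apply/measurable_EFinP; apply: measurable_funD; apply: measurable_power.
- by move=> x _; rewrite lee_fin addr_ge0 // power_ge0.
- by rewrite lee_fin invr_ge0 pi_ge0.
rewrite lee_pdivlMl ?pi_gt0 //.
under [leRHS]eq_integral do rewrite EFinD.
rewrite ge0_integralD //; last 4 first.
- by move=> x _; rewrite lee_fin power_ge0.
- by apply/measurable_EFinP; apply: measurable_power.
- by move=> x _; rewrite lee_fin power_ge0.
- by apply/measurable_EFinP; apply: measurable_power.
have split_sq (h : R -> R) : measurable_fun setT h -> (forall x, h x ^+ 2 <= sqn (g x)) ->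
    mu.-integrable setT (fun x => (h x ^+ 2)%:E).
  move=> mh hg; apply/integrableP; split; first by apply/measurable_EFinP; exact: measurable_funX.
  apply: le_lt_trans ga2; apply: ge0_le_integral => //.
  - by apply: measurableT_comp => //; apply/measurable_EFinP; exact: measurable_funX.
  - exact: measurable_wsqn.
  - by move=> x _; rewrite lee_fin mul1r ger0_norm ?sqr_ge0.
have [ma mb] := mg.
under [X in (_ * X <= _)%E]eq_integral do rewrite mul1r EFinD.
rewrite ge0_integralD //; last 4 first.
- by move=> x _; rewrite lee_fin sqr_ge0.
- by apply/measurable_EFinP; exact: measurable_funX.
- by move=> x _; rewrite lee_fin sqr_ge0.
- by apply/measurable_EFinP; exact: measurable_funX.
rewrite ge0_muleDr; last 2 first.
- by apply: integral_ge0 => x _; rewrite lee_fin sqr_ge0.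
- by apply: integral_ge0 => x _; rewrite lee_fin sqr_ge0.
apply: leeD; apply: plancherel_real_le => //; apply: split_sq => // x.
  by rewrite lerDl sqr_ge0.
by rewrite lerDr sqr_ge0.
Qed.

End Plancherel.
End ComplexL2.

(** * Quadratic variation in U^2 *)

Section CauchySchwarz.
Variable R : realType.

Lemma cabsD (x y : R[i]) : cabs (x + y) <= cabs x + cabs y.
Proof. exact: (le_normcD x y). Qed.

Lemma cabs_le (z : R[i]) (r : R) : 0 <= r -> (cabs z <= r) = (sqn R z <= r ^+ 2).
Proof. by move=> r0; rewrite -cabs_sqr ler_sqr ?nnegrE // cabs_ge0. Qed.

(** Cauchy-Schwarz with weights |c_j|. *)
Lemma sqn_sum_le n (c y : nat -> R[i]) :
  sqn R (\sum_(j < n) c j * y j) <=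
  (\sum_(j < n) cabs (c j)) * (\sum_(j < n) cabs (c j) * sqn R (y j)).
Proof.
elim: n => [|n IH]; first by rewrite !big_ord0 /sqn /= expr0n mul0r addr0.
rewrite !big_ord_recr /=.
have P0 : 0 <= \sum_(j < n) cabs (c j) by apply: sumr_ge0 => j _; exact: cabs_ge0.
have Q0 : 0 <= \sum_(j < n) cabs (c j) * sqn R (y j).
  by apply: sumr_ge0 => j _; rewrite mulr_ge0 ?cabs_ge0 ?sqn_ge0.
move: IH P0 Q0.
move: (\sum_(j < n) _) => A; move: (\sum_(j < n) _) => P; move: (\sum_(j < n) _) => Q.
rewrite -!cabs_sqr => IH P0 Q0.
have h : cabs (A + c n * y n) <= cabs A + cabs (c n) * cabs (y n).
  apply: (le_trans (cabsD _ _)); rewrite lerD2l cabs_le ?mulr_ge0 ?cabs_ge0 //.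
  by rewrite sqnM exprMn !cabs_sqr.
apply: (@le_trans _ _ ((cabs A + cabs (c n) * cabs (y n)) ^+ 2)).
  by rewrite ler_sqr ?nnegrE ?cabs_ge0 // addr_ge0 ?mulr_ge0 ?cabs_ge0.
have := cabs_ge0 R A; have := cabs_ge0 R (c n); have := cabs_ge0 R (y n).
move: (cabs A) (cabs (c n)) (cabs (y n)) IH {h} => a p q IH q0 p0 a0.
(* arithmetic-geometric mean inequality for P q^2 and Q, as a^2 <= P Q *)
have key : 2 * (a * q) <= P * q ^+ 2 + Q.
  rewrite -ler_sqr ?nnegrE ?mulr_ge0 ?addr_ge0 ?mulr_ge0 ?sqr_ge0 //.
  have := sqr_ge0 (P * q ^+ 2 - Q); have := ler_wpM2r (sqr_ge0 q) IH.
  rewrite !expr2; nra.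
have := ler_wpM2l p0 key; rewrite !expr2 in IH *; nra.
Qed.

End CauchySchwarz.

Section Variation.
Variable R : realType.
Local Notation mu := (@lebesgue_measure R).

Definition step_function (K : nat) (t : nat -> \bar R) (phi : nat -> R[i]) (r : R) : R[i] :=
  \sum_(k < K) (if (t k <= r%:E < t k.+1)%E then phi k else 0).

(** An increment of a step function is a combination of the phi_k whose
    coefficients are increments of indicators of intervals.  For a fixed pair of
    times at most two coefficients are nonzero, as the intervals are disjoint,
    and for a fixed interval the indicator jumps at most twice along the
    sequence of times.  Each of these bounds contributes a factor 2 in
    Cauchy-Schwarz. *)
Lemma step_variation (K m : nat) (t : nat -> \bar R) (phi : nat -> R[i]) (s : nat -> R) :
  (forall k, (k < K)%N -> (t k < t k.+1)%E) -> (forall i, s i <= s i.+1) ->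
  \sum_(i < m) sqn R (step_function K t phi (s i.+1) - step_function K t phi (s i))
    <= 4 * \sum_(k < K) sqn R (phi k).
Proof.
move=> tK sm; set a := step_function K t phi.
(* the indicator of an interval is a difference of two monotone indicators of
   rays, for which both sums below telescope *)
pose J k (r : R) : R := (t k <= r%:E)%E%:R.
pose c i k : R := (J k (s i.+1) - J k.+1 (s i.+1)) - (J k (s i) - J k.+1 (s i)).
have aE r : a r = \sum_(k < K) (J k r - J k.+1 r)%:C * phi k.
  apply: eq_bigr => k _; rewrite /J ltNge.
  case: (boolP (t k.+1 <= r%:E)%E) => h1.
    by rewrite (le_trans (ltW (tK k (ltn_ord k))) h1) /= subrr rmorph0 mul0r.
  by rewrite /= andbT; case: ifP => _; rewrite subr0 ?rmorph1 ?rmorph0 ?mul1r ?mul0r.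
have dE i : a (s i.+1) - a (s i) = \sum_(k < K) (c i k)%:C * phi k.
  rewrite !aE -sumrB; apply: eq_bigr => k _.
  by rewrite -mulrBl -rmorphB.
have cabsE (x : R) : cabs x%:C = `|x|.
  by rewrite /cabs /= expr0n addr0 sqrtr_sqr.
have Jm k i : J k (s i) <= J k (s i.+1).
  rewrite /J ler_nat; case: (boolP (t k <= (s i)%:E)%E) => // h.
  by rewrite (le_trans h) // lee_fin.
have J01 k r : 0 <= J k r <= 1 by rewrite /J ler0n lern1; case: (_ <= _)%E.
have JS k r : (k < K)%N -> J k.+1 r <= J k r.
  move=> kK; rewrite /J ler_nat; case: (boolP (t k.+1 <= r%:E)%E) => // h.
  by rewrite (le_trans (ltW (tK k kK)) h).
have sumk i : \sum_(k < K) `|c i k| <= 2.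
  have tel r : \sum_(k < K) (J k r - J k.+1 r) <= 1.
    rewrite -(big_mkord xpredT (fun k => J k r - J k.+1 r)).
    have := telescope_sumr (J^~ r) (leq0n K).
    under [in X in X -> _]eq_bigr do rewrite -opprB.
    rewrite sumrN => /(congr1 -%R); rewrite opprK opprB => ->.
    by have /andP[] := J01 0%N r; have /andP[] := J01 K r; lra.
  apply: (@le_trans _ _ (\sum_(k < K) (J k (s i.+1) - J k.+1 (s i.+1)) +
     \sum_(k < K) (J k (s i) - J k.+1 (s i)))).
    rewrite -big_split /=; apply: ler_sum => k _; rewrite /c (le_trans (ler_normB _ _)) //.
    by rewrite !ger0_norm ?subr_ge0 ?JS.
  by rewrite (le_trans (lerD (tel _) (tel _))).
have sumi k : \sum_(i < m) `|c i k| <= 2.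
  have tel l : \sum_(i < m) (J l (s i.+1) - J l (s i)) <= 1.
    rewrite -(big_mkord xpredT (fun i => J l (s i.+1) - J l (s i))).
    rewrite (telescope_sumr (fun i => J l (s i)) (leq0n m)).
    by have /andP[] := J01 l (s 0%N); have /andP[] := J01 l (s m); lra.
  apply: (@le_trans _ _ (\sum_(i < m) (J k (s i.+1) - J k (s i)) +
     \sum_(i < m) (J k.+1 (s i.+1) - J k.+1 (s i)))).
    rewrite -big_split /=; apply: ler_sum => i _.
    rewrite (_ : c i k = (J k (s i.+1) - J k (s i)) - (J k.+1 (s i.+1) - J k.+1 (s i))).
      by rewrite (le_trans (ler_normB _ _)) // !ger0_norm ?subr_ge0.
    by rewrite /c; ring.
  by rewrite (le_trans (lerD (tel _) (tel _))).
apply: (@le_trans _ _ (\sum_(i < m) 2 * \sum_(k < K) `|c i k| * sqn R (phi k))).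
  apply: ler_sum => i _; rewrite dE.
  apply: (le_trans (sqn_sum_le R K (fun k => (c i k)%:C) phi)).
  under eq_bigr do rewrite cabsE; under [X in _ * X]eq_bigr do rewrite cabsE.
  by rewrite ler_wpM2r // sumr_ge0 // => k _; rewrite mulr_ge0 ?sqn_ge0.
rewrite -mulr_sumr exchange_big /= (_ : 4 = 2 * 2); last by ring.
rewrite -mulrA ler_wpM2l // mulr_sumr ler_sum // => k _.
by rewrite -mulr_suml ler_wpM2r ?sqn_ge0.
Qed.

End Variation.

Section VariationUp.
Variable R : realType.
Local Notation mu := (@lebesgue_measure R).
Local Notation Q := (wnorm2 R (cst 1%R)).

Lemma atom_cmeasurable (a : R -> R -> R[i]) (r : R) :
  Up_atom 2 a -> cmeasurable (a r).
Proof.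
move=> [K [t [phi [_ _ iphi _ aE]]]].
rewrite (_ : a r = fun x => \sum_(k < K) (if (t k <= r%:E < t k.+1)%E then phi k x else 0));
  last by apply/funext => x; exact: aE.
apply: (@cmeasurable_sum R 'I_K (index_enum 'I_K)
  (fun k x => if (t k <= r%:E < t k.+1)%E then phi k x else 0)) => k.
case: (t k <= r%:E < t k.+1)%E; last exact: cmeasurable_cst.
by have [] := iphi k (ltn_ord k).
Qed.

Lemma integral_sum_ge0 (n : nat) (F : nat -> R -> R) :
  (forall i, (i < n)%N -> measurable_fun setT (F i)) -> (forall i x, 0 <= F i x) ->
  (\int[mu]_x (\sum_(i < n) F i x)%:E = \sum_(i < n) \int[mu]_x (F i x)%:E)%E.
Proof.
move=> mF F0.
under eq_integral do rewrite -sumEFin.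
rewrite ge0_integral_sum //.
- by move=> i; apply/measurable_EFinP; exact: mF.
- by move=> i x _; rewrite lee_fin.
Qed.

Lemma atom_variation (a : R -> R -> R[i]) (s : nat -> R) (m : nat) :
  Up_atom 2 a -> (forall i, s i <= s i.+1) ->
  (\sum_(i < m) Q (fun x => a (s i.+1) x - a (s i) x)%R <= 4%:E)%E.
Proof.
move=> aa sm; have ma r := atom_cmeasurable a r aa.
have md i : cmeasurable (fun x => a (s i.+1) x - a (s i) x) by exact: cmeasurableB.
have [K [t [phi [_ tK iphi sphi aE]]]] := aa.
have aS r x : a r x = step_function R K t (phi^~ x) r by exact: aE.
have mphi k : (k < K)%N -> measurable_fun setT (fun x => sqn R (phi k x)).
  by move=> kK; apply: cmeasurable_sqn; have [] := iphi k kK.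
rewrite /wnorm2 /=; under eq_bigr do under eq_integral do rewrite mul1r.
rewrite -(integral_sum_ge0 m (fun i x => sqn R (a (s i.+1) x - a (s i) x))); last 2 first.
- by move=> i _; exact: cmeasurable_sqn.
- by move=> i x; exact: sqn_ge0.
apply: (@le_trans _ _ (\int[mu]_x (4%:E * (\sum_(k < K) sqn R (phi k x))%:E))%E).
  apply: ge0_le_integral => //.
  - by move=> x _; rewrite lee_fin sumr_ge0 // => i _; exact: sqn_ge0.
  - by apply/measurable_EFinP; apply: measurable_sum => i; exact: cmeasurable_sqn.
  - apply: measurable_funeM; apply/measurable_EFinP; apply: measurable_sum => k.
    exact: mphi.
  - move=> x _; rewrite -EFinM lee_fin.
    under eq_bigr do rewrite !aS.
    exact: step_variation.
rewrite ge0_integralZl //; last 2 first.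
- by apply/measurable_EFinP; apply: measurable_sum => k; exact: mphi.
- by move=> x _; rewrite lee_fin sumr_ge0 // => i _; exact: sqn_ge0.
rewrite (integral_sum_ge0 K (fun k x => sqn R (phi k x))) //; last first.
  by move=> i x; exact: sqn_ge0.
rewrite (_ : \sum_(k < K) _ = 1)%E ?mule1 // -sphi.
apply: eq_bigr => k _; rewrite L2norm_sqr; apply: eq_integral => x _.
by rewrite mul1r.
Qed.

Lemma wnorm2_cst1_ge0 f : (0 <= Q f)%E.
Proof. by apply: wnorm2_ge0. Qed.

(** Cauchy-Schwarz with weights |lambda_j| reduces the variation of the
    combination to those of the atoms; this is the triangle inequality for the
    square root of the quadratic variation. *)
Lemma partial_variation (lambda : nat -> R[i]) (a : nat -> R -> R -> R[i])
    (s : nat -> R) (m n : nat) (L : R) :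
  (forall j, Up_atom 2 (a j)) -> (forall i, s i <= s i.+1) ->
  \sum_(j < n) cabs (lambda j) <= L ->
  (\sum_(i < m) Q (fun x => \sum_(j < n) lambda j * a j (s i.+1) x
                          - \sum_(j < n) lambda j * a j (s i) x)%R <= (4 * L ^+ 2)%:E)%E.
Proof.
move=> aa sm lL; have ma j r := atom_cmeasurable (a j) r (aa j).
have L0 : 0 <= L by apply: le_trans lL; apply: sumr_ge0 => j _; exact: cabs_ge0.
have md j i : cmeasurable (fun x => a j (s i.+1) x - a j (s i) x) by exact: cmeasurableB.
pose S := (\sum_(j < n) (cabs (lambda j))%:E *
    \sum_(i < m) Q (fun x => a j (s i.+1) x - a j (s i) x)%R)%E.
have SL : (S <= (4 * L)%:E)%E.
  apply: (@le_trans _ _ (\sum_(j < n) (cabs (lambda j))%:E * 4%:E)%E).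
    apply: lee_sum => j _; rewrite lee_wpmul2l ?lee_fin ?cabs_ge0 //.
    exact: (atom_variation (a j) s m (aa j) sm).
  by rewrite -ge0_sume_distrl ?sumEFin -?EFinM ?lee_fin //; 
    [rewrite mulrC ler_wpM2l|move=> j _; rewrite lee_fin cabs_ge0].
apply: (@le_trans _ _ (L%:E * S)%E); last first.
  rewrite (_ : 4 * L ^+ 2 = L * (4 * L)) ?EFinM; last by ring.
  by rewrite -EFinM lee_wpmul2l ?lee_fin.
have -> : (L%:E * S = \sum_(i < m) (L%:E * \sum_(j < n) (cabs (lambda j))%:E *
    Q (fun x => a j (s i.+1) x - a j (s i) x)%R))%E.
  rewrite /S -ge0_sume_distrr; last first.
    by move=> i _; apply: sume_ge0 => j _; rewrite mule_ge0 ?lee_fin ?cabs_ge0 ?wnorm2_cst1_ge0.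
  rewrite exchange_big /=; congr (_ * _)%E; apply: eq_bigr => j _.
  by rewrite ge0_sume_distrr // => i _; exact: wnorm2_cst1_ge0.
apply: lee_sum => i _.
have -> : (\sum_(j < n) (cabs (lambda j))%:E * Q (fun x => a j (s i.+1) x - a j (s i) x)%R
   = \int[mu]_x (\sum_(j < n) cabs (lambda j) * sqn R (a j (s i.+1) x - a j (s i) x))%:E)%E.
  rewrite (integral_sum_ge0 n (fun j x => cabs (lambda j) * sqn R (a j (s i.+1) x - a j (s i) x))).
  - apply: eq_bigr => j _; rewrite -ge0_integralZl //.
    + by apply: eq_integral => x _; rewrite -EFinM mul1r.
    + exact: measurable_wsqn.
    + by move=> x _; rewrite lee_fin mul1r sqn_ge0.
    + by rewrite lee_fin cabs_ge0.
  - by move=> j _; apply: measurable_funM => //; exact: cmeasurable_sqn.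
  - by move=> j x; rewrite mulr_ge0 ?cabs_ge0 ?sqn_ge0.
have mS : measurable_fun setT (fun x =>
    \sum_(j < n) cabs (lambda j) * sqn R (a j (s i.+1) x - a j (s i) x)).
  apply: measurable_sum => j; apply: measurable_funM => //; exact: cmeasurable_sqn.
have S0 x : 0 <= \sum_(j < n) cabs (lambda j) * sqn R (a j (s i.+1) x - a j (s i) x).
  by apply: sumr_ge0 => j _; rewrite mulr_ge0 ?cabs_ge0 ?sqn_ge0.
rewrite -ge0_integralZl //; last 2 first.
- exact/measurable_EFinP.
- by move=> x _; rewrite lee_fin.
apply: ge0_le_integral => //.
- by move=> x _; rewrite lee_fin mul1r sqn_ge0.
- apply: measurable_wsqn => //; apply: cmeasurableB; apply: cmeasurable_sum => j;
    apply: cmeasurableM => //; exact: cmeasurable_cst.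
- by apply: measurable_funeM; exact/measurable_EFinP.
move=> x _; rewrite mul1r -EFinM lee_fin -sumrB.
under eq_bigr do rewrite -mulrBr.
apply: (le_trans (sqn_sum_le R n lambda (fun j => a j (s i.+1) x - a j (s i) x))).
by rewrite ler_wpM2r.
Qed.

End VariationUp.

Section UpVariation.
Variable R : realType.
Local Notation mu := (@lebesgue_measure R).
Local Notation Q := (wnorm2 R (cst 1%R)).

Lemma poweR2_le (x : \bar R) (e : R) : 0 <= e -> (0 <= x)%E ->
  (x `^ 2 <= (e ^+ 2)%:E)%E = (x <= e%:E)%E.
Proof.
move=> e0; case: x => [x| |] // x0.
  by rewrite poweR_EFin !lee_fin powR_mulrn // ler_sqr ?nnegrE.
by rewrite poweRyr // ?pnatr_eq0.
Qed.

Lemma cvg0_poweR2 (T : Type) (F : set_system T) (FF : Filter F) (f : T -> \bar R) :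
  (forall x, 0 <= f x)%E -> (f @ F --> 0)%E -> ((f x `^ 2)%E @[x --> F] --> 0)%E.
Proof.
move=> f0 f_cvg; apply: (@squeeze_cvge _ _ _ _ (cst 0%E) _ f) => //; last exact: cvg_cst.
have small := cvg0_near_lt R T F FF f 1 ltr01 f_cvg.
near=> x; rewrite poweR_ge0 andTb.
have : (f x < 1)%E by near: x; exact: small.
move: (f0 x); case: (f x) => [r| |] //; rewrite ?lee_fin ?lte_fin => r0 r1.
by rewrite powR_mulrn // expr2 ler_piMr // ltW.
Unshelve. all: by end_near. Qed.

Lemma sqnD3 (x y z : R[i]) : sqn R (x + y - z) <= 3 * (sqn R x + sqn R y + sqn R z).
Proof.
case: x => a b; case: y => c d; case: z => p q; rewrite /sqn /=.
have K (u v w : R) : (u + v - w) ^+ 2 <= 3 * (u ^+ 2 + v ^+ 2 + w ^+ 2).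
  have := sqr_ge0 (u - v); have := sqr_ge0 (u + w); have := sqr_ge0 (v + w).
  rewrite !expr2; nra.
by have := K a c p; have := K b d q; lra.
Qed.

Lemma wnorm2D3 (w : R -> R) (f g h : R -> R[i]) :
  measurable_fun setT w -> (forall x, 0 <= w x) ->
  cmeasurable f -> cmeasurable g -> cmeasurable h ->
  (wnorm2 R w (fun x => f x + g x - h x)%R <=
    3%:E * (wnorm2 R w f + wnorm2 R w g + wnorm2 R w h))%E.
Proof.
move=> mw w0 mf mg mh.
have ge0 (k : R -> R[i]) x : (0 <= (w x * sqn R (k x))%:E)%E.
  by rewrite lee_fin mulr_ge0 ?sqn_ge0.
have mm (k : R -> R[i]) : cmeasurable k -> measurable_fun setT (fun x => (w x * sqn R (k x))%:E).
  by move=> mk; exact: measurable_wsqn.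
rewrite /wnorm2 -!ge0_integralD //; try exact: mm; last 2 first.
- by move=> x _; rewrite adde_ge0.
- by apply: emeasurable_funD; exact: mm.
rewrite -ge0_integralZl //; last 2 first.
- by apply: emeasurable_funD; [apply: emeasurable_funD|]; exact: mm.
- by move=> x _; rewrite !adde_ge0.
apply: ge0_le_integral => //.
- by move=> x _; exact: (ge0 (fun x => f x + g x - h x)).
- by apply: mm; apply: cmeasurableB => //; exact: cmeasurableD.
- apply: measurable_funeM; apply: emeasurable_funD; [apply: emeasurable_funD|]; exact: mm.
- move=> x _; rewrite -!EFinD -EFinM lee_fin -!mulrDr mulrCA ler_wpM2l //.
  exact: sqnD3.
Qed.

Lemma series_le (c : nat -> R[i]) n (L : R) :
  (\sum_(0 <= j <oo) (cabs (c j))%:E = L%:E)%E -> \sum_(j < n) cabs (c j) <= L.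
Proof.
move=> cL; rewrite -lee_fin -cL -sumEFin -(big_mkord xpredT (fun j => (cabs (c j))%:E)).
by apply: nneseries_lim_ge => j _ _; rewrite lee_fin cabs_ge0.
Qed.

(** A partial sum W_n of the representation has variation at most 4 L^2, and an
    increment of u is the increment of W_n plus two errors that tend to 0.  The
    square of a sum of three terms costs a factor 3, so 12 = 3 * 4. *)
Lemma repr_variation (u : R -> R -> R[i]) (lambda : nat -> R[i]) a (s : nat -> R) m (L : R) :
  (forall t, cmeasurable (u t)) -> Up_repr 2 u lambda a ->
  (\sum_(0 <= j <oo) (cabs (lambda j))%:E = L%:E)%E ->
  (forall i, s i <= s i.+1) ->
  (\sum_(i < m) Q (fun x => u (s i.+1) x - u (s i) x)%R <= (12 * L ^+ 2)%:E)%E.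
Proof.
move=> mu_ [aa _ ucvg] lL sm.
have ma j r := atom_cmeasurable R (a j) r (aa j).
pose W n t x := \sum_(j < n) lambda j * a j t x.
have mW n t : cmeasurable (W n t).
  by apply: cmeasurable_sum => j; apply: cmeasurableM => //; exact: cmeasurable_cst.
pose e n t := Q (fun x => u t x - W n t x).
have ecvg t : (e n t @[n --> \oo] --> 0)%E.
  rewrite (_ : (fun n => e n t) = fun n => (L2norm (fun x => u t x - W n t x)%R `^ 2)%E).
    by apply: cvg0_poweR2 => [n|]; [exact: L2norm_ge0|exact: ucvg].
  by apply/funext => n; rewrite L2norm_sqr.
have e0 n t : (0 <= e n t)%E by exact: wnorm2_cst1_ge0.
have step_n n : (\sum_(i < m) Q (fun x => u (s i.+1) x - u (s i) x)%R <=
    (12 * L ^+ 2)%:E + 3%:E * \sum_(i < m) (e n (s i.+1) + e n (s i)))%E.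
  have bound := partial_variation R lambda a s m n L aa sm (series_le lambda n L lL).
  have -> : (12 * L ^+ 2)%:E = (3%:E * (4 * L ^+ 2)%:E)%E.
    by rewrite -EFinM; congr EFin; ring.
  rewrite -ge0_muleDr; last 2 first.
  - by rewrite lee_fin mulr_ge0 // sqr_ge0.
  - by apply: sume_ge0 => i _; rewrite adde_ge0.
  apply: (@le_trans _ _ (3%:E * (\sum_(i < m) Q (fun x => W n (s i.+1) x - W n (s i) x)%R
       + \sum_(i < m) (e n (s i.+1) + e n (s i))))%E); last first.
    by rewrite lee_wpmul2l // leeD2r.
  rewrite -big_split /= ge0_sume_distrr; last first.
    by move=> i _; apply: adde_ge0; [exact: wnorm2_cst1_ge0|exact: adde_ge0].
  apply: lee_sum => i _; rewrite addeA.
  have := wnorm2D3 (cst 1) (fun x => W n (s i.+1) x - W n (s i) x)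
    (fun x => u (s i.+1) x - W n (s i.+1) x) (fun x => u (s i) x - W n (s i) x).
  rewrite (_ : (fun x => _ + _ - _) = (fun x => u (s i.+1) x - u (s i) x)); last first.
    by apply/funext => x; ring.
  by apply => //; exact: cmeasurableB.
have lim0 : ((12 * L ^+ 2)%:E + 3%:E * \sum_(i < m) (e n (s i.+1) + e n (s i)) @[n --> \oo]
    --> (12 * L ^+ 2)%:E)%E.
  rewrite -[X in _ --> X]adde0; apply: cvgeD => //; first exact: cvg_cst.
  rewrite -[X in _ --> X](mule0 3%:E); apply: cvgeZl => //.
  rewrite [X in _ --> X](_ : _ = \sum_(i < m) 0)%E; last by rewrite big1.
  apply: cvg_nnesum => [i _|i _]; first by apply: nearW => n; rewrite adde_ge0.
  by rewrite -[X in _ --> X](adde0 0%E); apply: cvgeD.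
by apply: (cvge_to_ge lim0); apply: nearW.
Qed.

(** The embedding of U^2 into the functions of bounded quadratic variation, by
    taking the infimum over all representations. *)
Theorem up_variation (u : R -> R -> R[i]) (s : nat -> R) m :
  inUp 2 u -> (forall i, s i <= s i.+1) ->
  (\sum_(i < m) Q (fun x => u (s i.+1) x - u (s i) x)%R <= 12%:E * Up_norm 2 u `^ 2)%E.
Proof.
move=> [uL2 [lambda0 [a0 repr0]]] sm.
have mu_ t : cmeasurable (u t) by have [] := uL2 t.
set V := (\sum_(i < m) _)%E.
have V0 : (0 <= V)%E by apply: sume_ge0 => i _; exact: wnorm2_cst1_ge0.
have fin_series (c : nat -> R[i]) : (\sum_(0 <= j <oo) (cabs (c j))%:E < +oo)%E ->
    exists2 L, 0 <= L & (\sum_(0 <= j <oo) (cabs (c j))%:E = L%:E)%E.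
  move=> cfin; have c0 : (0 <= \sum_(0 <= j <oo) (cabs (c j))%:E)%E.
    by apply: nneseries_ge0 => j _ _; rewrite lee_fin cabs_ge0.
  move: cfin c0; case: (\sum_(0 <= j <oo) _)%E => [L| |] // _ L0.
  by exists L.
have Vle (c : nat -> R[i]) b : Up_repr 2 u c b ->
    exists2 L, 0 <= L & (\sum_(0 <= j <oo) (cabs (c j))%:E = L%:E)%E /\ (V <= (12 * L ^+ 2)%:E)%E.
  move=> rcb; have [_ cfin _] := rcb; have [L L0 cL] := fin_series c cfin.
  by exists L => //; split => //; exact: (repr_variation u c b).
have [L0 L00 [_ VL0]] := Vle _ _ repr0.
have [v vE] : exists v, V = v%:E.
  by exists (fine V); rewrite fineK // ge0_fin_numE // (le_lt_trans VL0) // ltry.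
have v0 : 0 <= v by move: V0; rewrite vE.
(* the infimum is over L, while the bound is in L^2: take square roots first *)
pose q := Num.sqrt (v / 12).
have q2 : 12 * q ^+ 2 = v by rewrite sqr_sqrtr ?divr_ge0 // mulrC divfK.
have qU : (q%:E <= Up_norm 2 u)%E.
  apply: le_ereal_inf_tmp => _ [c [b [rcb ->]]].
  have [L L0' [-> VL]] := Vle _ _ rcb.
  rewrite lee_fin -ler_sqr ?nnegrE ?sqrtr_ge0 //.
  by move: VL; rewrite vE lee_fin -q2 ler_pM2l.
rewrite vE -q2 EFinM lee_wpmul2l //.
rewrite -(powR_mulrn 2 (sqrtr_ge0 _)) -poweR_EFin.
apply: gt0_ler_poweR => //; rewrite ?in_itv/= ?leey ?andbT ?lee_fin ?sqrtr_ge0 //.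
by apply: le_trans qU; rewrite lee_fin sqrtr_ge0.
Qed.

End UpVariation.

(** * Littlewood-Paley decomposition *)

Section Cutoff.
Variables (R : realType) (chi : R -> R).
Hypothesis hchi : LPcutoff chi.

Lemma cutoff_continuous : continuous chi.
Proof. by have [sm _ _ _ _] := hchi; apply: derivable_continuous => x; exact: (sm 0%N). Qed.

Lemma cutoff_out x : 2 <= `|x| -> chi x = 0.
Proof.
move=> x2; apply: contra_notP (_ : ~ `|x| < 2); last by move=> /lt_le_trans /(_ x2); rewrite ltxx.
move=> /eqP cx; have [_ sub _ _ _] := hchi.
have /sub : closure [set x | chi x != 0] x by exact: subset_closure.
by rewrite /= in_itv/= ltr_norml.
Qed.

Lemma cutoff_bounded : exists2 C, 0 <= C & forall x, `|chi x| <= C.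
Proof.
have [c _ hc] : exists2 c, c \in `[- 2, 2] & forall t, t \in `[- 2, 2] -> chi t <= chi c.
  by apply: EVT_max; [lra|apply: continuous_subspaceT; exact: cutoff_continuous].
have [_ _ _ c0 _] := hchi; exists (chi c) => // x; rewrite ger0_norm //.
case: (leP 2 `|x|) => x2; first by rewrite cutoff_out.
by apply: hc; rewrite in_itv/= -ler_norml ltW.
Qed.

Local Notation psi := (LPpsi chi).

Lemma psi_out x : 2 <= `|x| -> psi x = 0.
Proof.
move=> x2; rewrite /LPpsi !cutoff_out ?subrr // normrM (@ger0_norm _ 2) //.
by rewrite (le_trans x2) // ler_peMl // ler1n.
Qed.

Lemma psi0 : psi 0 = 0.
Proof. by rewrite /LPpsi mulr0 subrr. Qed.

Lemma psi_measurable : measurable_fun setT psi.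
Proof.
apply: measurable_funB; first by apply: continuous_measurable_fun; exact: cutoff_continuous.
apply: measurableT_comp; last exact: mulrl_measurable.
by apply: continuous_measurable_fun; exact: cutoff_continuous.
Qed.

Lemma psi_bounded : exists2 C, 0 <= C & forall x, `|psi x| <= C.
Proof.
have [C C0 hC] := cutoff_bounded; exists (C + C) => [|x]; first exact: addr_ge0.
by rewrite (le_trans (ler_normB _ _)) // lerD.
Qed.

(** On N <= |x| < 2N the blocks N and 2N of the partition of unity are the only
    ones that do not vanish; they sum to 1, so the sum of their squares is at
    least 1/2. *)
Lemma psi_pair (N x : R) : 0 < N -> N <= `|x| -> `|x| < 2 * N ->
  1 <= 2 * (psi (N^-1 * x) ^+ 2 + psi ((2 * N)^-1 * x) ^+ 2).
Proof.
move=> N0 Nx xN; have N20 : 0 < 2 * N by rewrite mulr_gt0.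
have [_ _ _ _ c1] := hchi.
have e1 : chi (2 * (N^-1 * x)) = 0.
  apply: cutoff_out; rewrite !normrM normfV (gtr0_norm N0) (@ger0_norm _ 2) //.
  by rewrite -[leLHS]mulr1 ler_wpM2l // mulrC ler_pdivlMr // mul1r.
have e2 : chi ((2 * N)^-1 * x) = 1.
  by apply: c1; rewrite normrM normfV (gtr0_norm N20) mulrC ler_pdivrMr // mul1r ltW.
have e3 : 2 * ((2 * N)^-1 * x) = N^-1 * x by field; rewrite gt_eqF.
rewrite /LPpsi e1 e2 e3 subr0.
by have := sqr_ge0 (2 * chi (N^-1 * x) - 1); rewrite !expr2; nra.
Qed.

Lemma dyadic_gt0 (k : int) : 0 < dyadic R k.
Proof. by rewrite /dyadic exprz_gt0. Qed.

Lemma dyadicS (k : int) : dyadic R (k + 1) = 2 * dyadic R k.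
Proof. by rewrite /dyadic exprzDr ?unitfE // expr1z mulrC. Qed.

(** Makes a sum over the exponents -n, ..., n a sum over ordinals. *)
Definition kindex (n m : nat) : int := m%:Z - n%:Z.

Lemma dyadic_locate (n : nat) (y : R) : dyadic R (kindex n 0) <= y ->
  forall M, y < dyadic R (kindex n M) ->
  exists2 m, (m < M)%N & dyadic R (kindex n m) <= y < dyadic R (kindex n m.+1).
Proof.
move=> y1; elim => [|M IH]; first by move=> /(le_lt_trans y1); rewrite ltxx.
case: (ltP y (dyadic R (kindex n M))) => [/IH [m mM hm] _|h1 h2].
  by exists m => //; exact: ltnW.
by exists M => //; rewrite h1.
Qed.

Lemma hweight_half x : x != 0 -> hweight R (- 2^-1) x = `|x|^-1.
Proof.
move=> x0; rewrite /hweight -powR_mulrn ?powR_ge0 // -powRrM mulNr mulVf //.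
by rewrite powR_inv1.
Qed.

Lemma hweight_zero : hweight R (- 2^-1) 0 = 0.
Proof. by rewrite /hweight normr0 powR0 ?expr0n // oppr_eq0 invr_eq0. Qed.

Lemma sum_two_le (F : nat -> R) K m : (forall i, 0 <= F i) -> (m.+1 < K)%N ->
  F m + F m.+1 <= \sum_(i < K) F i.
Proof.
move=> F0; elim: K => [//|K IH]; rewrite ltnS leq_eqVlt => /predU1P[<-|mK].
  by rewrite !big_ord_recr /= -addrA lerDr sumr_ge0.
by rewrite big_ord_recr /= (le_trans (IH mK)) // lerDl.
Qed.

Lemma dyadic_kindex_double n : dyadic R (kindex n n.*2) = 2 ^+ n.
Proof. by rewrite /dyadic /kindex -addnn PoszD addrK exprnP. Qed.

Lemma dyadic_kindex0 n : dyadic R (kindex n 0) = (2 ^+ n)^-1.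
Proof. by rewrite /dyadic /kindex sub0r -invr_expz exprnP. Qed.

Lemma dyadic_kindexS n m : dyadic R (kindex n m.+1) = 2 * dyadic R (kindex n m).
Proof. by rewrite -dyadicS /kindex -addn1 PoszD addrAC. Qed.

Lemma block_weight_ge0 x n m :
  0 <= (dyadic R (kindex n m))^-1 * psi ((dyadic R (kindex n m))^-1 * x) ^+ 2.
Proof. by rewrite mulr_ge0 ?sqr_ge0 // invr_ge0 ltW // dyadic_gt0. Qed.

(** If N <= |x| < 2N, the blocks N and 2N contribute to the sum at least
    (2N)^(-1) / 2, which is at least |x|^(-1) / 4.  Both N and 2N are among
    the scales 2^(-n), ..., 2^n once n is large. *)
Lemma LP_weight x : \forall n \near \oo,
  hweight R (- 2^-1) x <= 4 * \sum_(m < n.*2.+1)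
     (dyadic R (kindex n m))^-1 * psi ((dyadic R (kindex n m))^-1 * x) ^+ 2.
Proof.
case: (eqVneq x 0) => [->|x0].
  apply: nearW => n; rewrite hweight_zero mulr_ge0 // sumr_ge0 // => m _.
  exact: block_weight_ge0.
have y0 : 0 < `|x| by rewrite normr_gt0.
near=> n; rewrite hweight_half //.
have pow2 : n%:R <= 2 ^+ n :> R by rewrite -natrX ler_nat ltnW // ltn_expl.
have large : `|x| < dyadic R (kindex n n.*2).
  rewrite dyadic_kindex_double; apply: lt_le_trans pow2.
  by near: n; exact: nbhs_infty_gtr.
have small : dyadic R (kindex n 0) <= `|x|.
  rewrite dyadic_kindex0 -[leRHS]invrK lef_pV2 ?posrE ?invr_gt0 ?exprn_gt0 //.
  by apply: le_trans pow2; near: n; exact: nbhs_infty_ger.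
have [m mn /andP[Nx xN]] := dyadic_locate n `|x| small n.*2 large.
rewrite dyadic_kindexS in xN.
have pair := psi_pair _ _ (dyadic_gt0 _) Nx xN.
have := sum_two_le (fun m => (dyadic R (kindex n m))^-1 *
   psi ((dyadic R (kindex n m))^-1 * x) ^+ 2) n.*2.+1 m (block_weight_ge0 x n).
rewrite ltnS => /(_ mn); rewrite dyadic_kindexS.
set S := \sum_(i < _) _; move: pair Nx (dyadic_gt0 (kindex n m)).
move: (dyadic R (kindex n m)) (psi _ ^+ 2) (psi _ ^+ 2)
  (sqr_ge0 (psi ((dyadic R (kindex n m))^-1 * x))).
move=> N p q p0 pq Nx N0 pqS.
have /le_trans : `|x|^-1 <= N^-1 by rewrite lef_pV2 ?posrE.
apply; have iN : 0 < N^-1 by rewrite invr_gt0.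
have : (2 * N)^-1 = 2^-1 * N^-1 by rewrite invfM.
move: pqS => /[swap] ->; nra.
Unshelve. all: by end_near. Qed.

End Cutoff.

Section LittlewoodPaleyBlocks.
Variables (R : realType) (chi : R -> R).
Hypothesis hchi : LPcutoff chi.
Local Notation mu := (@lebesgue_measure R).
Local Notation Q := (wnorm2 R (cst 1%R)).
Local Notation HQ := (wnorm2 R (hweight R (- 2^-1))).
Local Notation psi := (LPpsi chi).
Local Notation block k := (LPproj chi (dyadic R k)).

Lemma measurable_hweight s : measurable_fun setT (hweight R s).
Proof.
apply: measurable_funX.
apply: (@measurableT_comp _ _ _ _ _ _ (fun x : R => x `^ s) _ (fun x : R => `|x|)) => //.
Qed.

Lemma inH_HQ g : inH (- 2^-1) g -> (HQ g < +oo)%E.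
Proof. by move=> [_ gfin]; rewrite -Hnorm_sqr poweR_lty. Qed.

Lemma measurable_block_mult k : measurable_fun setT (fun x => psi ((dyadic R k)^-1 * x)).
Proof.
apply: (@measurableT_comp _ _ _ _ _ _ psi); first exact: psi_measurable.
exact: mulrl_measurable.
Qed.

Lemma cmeasurable_block k g : cmeasurable g -> cmeasurable (block k g).
Proof.
by move=> mg; apply: cmeasurableM => //; apply: cmeasurable_real; exact: measurable_block_mult.
Qed.

Lemma block_sqn k g x : sqn R (block k g x) = psi ((dyadic R k)^-1 * x) ^+ 2 * sqn R (g x).
Proof. by rewrite /LPproj sqnM sqn_real. Qed.

Lemma block_out k g x : 2 * dyadic R k <= `|x| -> block k g x = 0.
Proof.
move=> kx; rewrite /LPproj (psi_out R chi hchi) ?rmorph0 ?mul0r //.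
have k0 := dyadic_gt0 R k.
by rewrite normrM normfV (gtr0_norm k0) mulrC ler_pdivlMr.
Qed.

(** A block lives on |x| < 2N, where the weight |x|^(-1) is bounded below. *)
Lemma block_HQ k : exists2 C, 0 <= C & forall g x,
  sqn R (block k g x) <= C * (hweight R (- 2^-1) x * sqn R (g x)).
Proof.
have [C C0 hC] := psi_bounded R chi hchi.
have k0 := dyadic_gt0 R k; have c0 : 0 <= C ^+ 2 * (2 * dyadic R k).
  by rewrite mulr_ge0 ?sqr_ge0 // mulr_ge0 // ltW.
exists (C ^+ 2 * (2 * dyadic R k)) => // g x.
case: (leP (2 * dyadic R k) `|x|) => kx.
  rewrite block_out // {1}/sqn /= expr0n /= addr0.
  by rewrite mulr_ge0 // mulr_ge0 ?hweight_ge0 ?sqn_ge0.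
case: (eqVneq x 0) => [->|x0].
  rewrite block_sqn mulr0 psi0 expr0n /= mul0r.
  by rewrite mulr_ge0 // mulr_ge0 ?hweight_ge0 ?sqn_ge0.
rewrite block_sqn mulrA ler_wpM2r ?sqn_ge0 // hweight_half //.
have y0 : 0 < `|x| by rewrite normr_gt0.
apply: (@le_trans _ _ (C ^+ 2 * 1)).
  by rewrite mulr1 -[leLHS]real_normK ?num_real // ler_sqr ?nnegrE.
by rewrite -mulrA ler_wpM2l ?sqr_ge0 // ler_pdivlMr // mul1r ltW.
Qed.

Lemma block_Q_lty k g : inH (- 2^-1) g -> (Q (block k g) < +oo)%E.
Proof.
move=> Hg; have [mg _] := Hg; have [C C0 hC] := block_HQ k.
apply: (@le_lt_trans _ _ (C%:E * HQ g)%E); last first.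
  by apply: lte_mul_pinfty => //; exact: inH_HQ.
have w0 x : (0 <= (hweight R (- 2^-1) x * sqn R (g x))%:E)%E.
  by rewrite lee_fin mulr_ge0 ?hweight_ge0 ?sqn_ge0.
have mw : measurable_fun setT (fun x => (hweight R (- 2^-1) x * sqn R (g x))%:E).
  by apply: measurable_wsqn => //; exact: measurable_hweight.
rewrite /wnorm2 -ge0_integralZl //.
apply: ge0_le_integral => //.
- by move=> x _; rewrite lee_fin mul1r sqn_ge0.
- by apply: measurable_wsqn => //; exact: cmeasurable_block.
- exact: measurable_funeM.
- by move=> x _; rewrite mul1r -EFinM lee_fin.
Qed.

(** A function h supported in a bounded interval satisfies |h| <= 1 + h^2
    there, so it is integrable if it is square integrable. *)
Lemma block_integrable k g : inH (- 2^-1) g ->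
  mu.-integrable setT (fun x => (complex.Re (block k g x))%:E) /\
  mu.-integrable setT (fun x => (complex.Im (block k g x))%:E).
Proof.
move=> Hg; have [mg _] := Hg; have [mRe mIm] := cmeasurable_block k g mg.
pose I := `[- (2 * dyadic R k), 2 * dyadic R k]%classic.
have i1 : mu.-integrable setT (fun x => (\1_I x)%:E).
  exact: integrable_indic_itv.
have i2 : mu.-integrable setT (fun x => (sqn R (block k g x))%:E).
  apply/integrableP; split.
    by apply/measurable_EFinP; apply: cmeasurable_sqn; exact: cmeasurable_block.
  under eq_integral => x _ do rewrite gee0_abs ?lee_fin ?sqn_ge0 // -[sqn R _]mul1r.
  exact: block_Q_lty.
have i12 : mu.-integrable setT (fun x => ((\1_I x)%:E + (sqn R (block k g x))%:E)%E).
  exact: integrableD.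
have bound (h : R[i] -> R) : (forall z, h z ^+ 2 <= sqn R z) -> forall x,
    `|h (block k g x)| <= \1_I x + sqn R (block k g x).
  move=> hz x; have hx := hz (block k g x); rewrite indicE.
  case: (boolP (x \in I)) => xI.
    have := hx; rewrite -[leLHS]real_normK ?num_real //.
    have := sqr_ge0 (2 * `|h (block k g x)| - 1).
    rewrite /= mulr1n; move: `|_| (sqn R _) => p q; rewrite !expr2; lra.
  move: xI; rewrite notin_setE /I /= in_itv/= -ler_norml => /negP; rewrite -ltNge => /ltW xk.
  have s0 : sqn R 0 = 0 by rewrite /sqn /= expr0n addr0.
  move: hx; rewrite block_out // s0 /= mulr0n add0r => hx.
  have : h 0 ^+ 2 == 0 by rewrite eq_le hx sqr_ge0.
  by rewrite sqrf_eq0 => /eqP ->; rewrite normr0.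
have nn x : 0 <= \1_I x + sqn R (block k g x).
  by apply: addr_ge0; [rewrite indicE|exact: sqn_ge0].
split; apply: (le_integrable _ _ _ i12) => //; try exact/measurable_EFinP; move=> x _.
  rewrite -EFinD lee_fin [leRHS]ger0_norm //.
  by apply: (bound (@complex.Re R)) => z; rewrite lerDl sqr_ge0.
rewrite -EFinD lee_fin [leRHS]ger0_norm //.
by apply: (bound (@complex.Im R)) => z; rewrite lerDr sqr_ge0.
Qed.

Lemma IFTB (g h : R -> R[i]) x :
  mu.-integrable setT (fun x => (complex.Re (g x))%:E) ->
  mu.-integrable setT (fun x => (complex.Im (g x))%:E) ->
  mu.-integrable setT (fun x => (complex.Re (h x))%:E) ->
  mu.-integrable setT (fun x => (complex.Im (h x))%:E) ->
  IFT (fun xi => g xi - h xi) x = IFT g x - IFT h x.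
Proof.
move=> g1 g2 h1 h2.
have costB (a b : R -> R) : mu.-integrable setT (fun x => (a x)%:E) ->
    mu.-integrable setT (fun x => (b x)%:E) ->
    cost R (fun x => a x - b x) x = cost R a x - cost R b x.
  move=> ia ib; rewrite /cost -RintegralB //; try exact: integrable_cost.
  by congr Rintegral; apply/funext => y; rewrite mulrBr.
have sintB (a b : R -> R) : mu.-integrable setT (fun x => (a x)%:E) ->
    mu.-integrable setT (fun x => (b x)%:E) ->
    sint R (fun x => a x - b x) x = sint R a x - sint R b x.
  move=> ia ib; rewrite /sint -RintegralB //; try exact: integrable_sint.
  by congr Rintegral; apply/funext => y; rewrite mulrBr.
have eRe : (fun xi => complex.Re (g xi - h xi)) = fun xi => complex.Re (g xi) - complex.Re (h xi).
  by apply/funext => y; case: (g y); case: (h y).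
have eIm : (fun xi => complex.Im (g xi - h xi)) = fun xi => complex.Im (g xi) - complex.Im (h xi).
  by apply/funext => y; case: (g y); case: (h y).
have iB (a b : R -> R) : mu.-integrable setT (fun x => (a x)%:E) ->
    mu.-integrable setT (fun x => (b x)%:E) ->
    mu.-integrable setT (fun x => (a x - b x)%:E).
  by move=> ia ib; exact: (integrableB measurableT ia ib).
have iRe : mu.-integrable setT (fun x => (complex.Re (g x - h x))%:E).
  rewrite (_ : (fun x => _) = EFin \o (fun y => complex.Re (g y) - complex.Re (h y))).
    exact: iB.
  by rewrite -eRe.
have iIm : mu.-integrable setT (fun x => (complex.Im (g x - h x))%:E).
  rewrite (_ : (fun x => _) = EFin \o (fun y => complex.Im (g y) - complex.Im (h y))).
    exact: iB.
  by rewrite -eIm.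
rewrite !IFT_transforms // eRe eIm.
rewrite !costB // !sintB // -mulrBr; congr (_ * _).
by apply/eqP; rewrite eq_complex /=; apply/andP; split; apply/eqP; ring.
Qed.

End LittlewoodPaleyBlocks.

(** * Free evolution *)

Section FreeEvolution.
Variable R : realType.
Implicit Types (g : R -> R[i]) (s t : R).

Lemma cabsE (z : R[i]) : cabs z = Num.sqrt (sqn R z).
Proof. by case: z. Qed.

Lemma Sgroup_sqn t g x : sqn R (Sgroup t g x) = sqn R (g x).
Proof. by rewrite /Sgroup sqnM sqn_cexp mul1r. Qed.

Lemma cmeasurable_Sgroup t g : cmeasurable g -> cmeasurable (Sgroup t g).
Proof.
move=> mg; apply: cmeasurableM => //; apply: cmeasurable_cexp.
by apply: measurable_funM => //; apply: measurable_funX.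
Qed.

Lemma Hnorm_Sgroup s t g : Hnorm s (Sgroup t g) = Hnorm s g.
Proof. by apply: eq_Lnorm => x; rewrite !cabsE Sgroup_sqn. Qed.

Lemma inH_Sgroup s t g : inH s g -> inH s (Sgroup t g).
Proof. by move=> [mg gfin]; split; [exact: cmeasurable_Sgroup|rewrite Hnorm_Sgroup]. Qed.

Lemma cexp0 : cexp (0 : R) = 1.
Proof. by rewrite /cexp cos0 sin0. Qed.

Lemma cexpD t1 t2 : cexp (t1 + t2) = cexp t1 * cexp t2 :> R[i].
Proof.
by apply/eqP; rewrite eq_complex /= cosD sinD; apply/andP; split; apply/eqP; ring.
Qed.

Lemma SgroupK t g : Sgroup t (Sgroup (- t) g) = g.
Proof.
apply/funext => x; rewrite /Sgroup mulrA -cexpD.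
by rewrite mulNr subrr cexp0 mul1r.
Qed.

Lemma SgroupB t g h : Sgroup t (fun x => g x - h x) = fun x => Sgroup t g x - Sgroup t h x.
Proof. by apply/funext => x; rewrite /Sgroup mulrBr. Qed.

(** The interaction picture: v is a free evolution exactly when its profile is
    constant in time, and it scatters when its profile converges. *)
Definition profile (v : R -> R -> R[i]) t := Sgroup (- t) (v t).

End FreeEvolution.

(** * Quadratic variation in Z *)

Section ZVariation.
Variables (R : realType) (chi : R -> R).
Hypothesis hchi : LPcutoff chi.
Local Notation mu := (@lebesgue_measure R).
Local Notation Q := (wnorm2 R (cst 1%R)).
Local Notation HQ := (wnorm2 R (hweight R (- 2^-1))).
Local Notation psi := (LPpsi chi).
Local Notation block k := (LPproj chi (dyadic R k)).

Lemma Sback_block k v t : Sback (PN chi k v) t = IFT (block k (profile R v t)).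
Proof.
by congr IFT; apply/funext => x; rewrite /profile /PN /LPproj /Sgroup mulrCA.
Qed.

(** The passage from the frequency side, where H^(-1/2) is measured, to the
    space side, where U^2 is. *)
Lemma block_increment k v t1 t2 :
  inH (- 2^-1) (v t1) -> inH (- 2^-1) (v t2) ->
  (Q (block k (fun x => profile R v t2 x - profile R v t1 x)%R) <=
   Q (fun x => Sback (PN chi k v) t2 x - Sback (PN chi k v) t1 x)%R)%E.
Proof.
move=> v1 v2.
have H1 : inH (- 2^-1) (profile R v t1) by exact: inH_Sgroup.
have H2 : inH (- 2^-1) (profile R v t2) by exact: inH_Sgroup.
have [i1 j1] := block_integrable R chi hchi k _ H1.
have [i2 j2] := block_integrable R chi hchi k _ H2.
have bB : block k (fun x => profile R v t2 x - profile R v t1 x)%R =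
    fun x => block k (profile R v t2) x - block k (profile R v t1) x.
  by apply/funext => x; rewrite /LPproj mulrBr.
have -> : (fun x => Sback (PN chi k v) t2 x - Sback (PN chi k v) t1 x) =
    IFT (fun x => block k (profile R v t2) x - block k (profile R v t1) x).
  by apply/funext => x; rewrite !Sback_block IFTB.
rewrite bB; apply: plancherel_le.
- rewrite (_ : (fun x => _) = EFin \o (fun x => complex.Re (block k (profile R v t2) x)
     - complex.Re (block k (profile R v t1) x))).
    exact: (integrableB measurableT i2 i1).
  by apply/funext => x /=; case: (block k _ x); case: (block k _ x).
- rewrite (_ : (fun x => _) = EFin \o (fun x => complex.Im (block k (profile R v t2) x)
     - complex.Im (block k (profile R v t1) x))).
    exact: (integrableB measurableT j2 j1).
  by apply/funext => x /=; case: (block k _ x); case: (block k _ x).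
have m1 : cmeasurable (block k (profile R v t1)).
  by apply: cmeasurable_block => //; have [] := H1.
have m2 : cmeasurable (block k (profile R v t2)).
  by apply: cmeasurable_block => //; have [] := H2.
have := wnorm2D3 R (cst 1) (block k (profile R v t2)) (cst 0) (block k (profile R v t1)).
rewrite (_ : (fun x => _ + _ - _) =
    fun x => block k (profile R v t2) x - block k (profile R v t1) x).
  move=> /(_ (measurable_cst _) (fun _ => ler01) m2 (cmeasurable_cst _ _) m1).
  move=> /le_lt_trans; apply; apply: lte_mul_pinfty => //.
  have q1 := block_Q_lty R chi hchi k _ H1; have q2 := block_Q_lty R chi hchi k _ H2.
  have Q0 : Q (cst 0) = 0%E.
    by rewrite /wnorm2 integral0_eq // => x _; rewrite /sqn /= expr0n addr0 mulr0.
  by rewrite Q0 adde0 lte_add_pinfty.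
by apply/funext => x; rewrite /= addr0.
Qed.

Lemma esum_ge_kindex (F : int -> \bar R) n M : (forall k, 0 <= F k)%E ->
  (\sum_(m < M) F (kindex n m) <= \esum_(k in [set: int]) F k)%E.
Proof.
move=> F0; rewrite -(big_mkord xpredT (fun m => F (kindex n m))).
rewrite -(big_map (kindex n) xpredT F) fsbig_seq; last first.
  by rewrite map_inj_uniq ?iota_uniq // => i j /addIr [].
apply: esum_ge; exists [set` [seq kindex n i | i <- index_iota 0 M]] => //.
split; [exact: finite_seq|exact: subsetT].
Qed.

(** Up to the factor 4, the weight |xi|^(-1) is the sum over the blocks of
    N^(-1) times their squares.  For each block the variation is at most 12 times
    the square of its U^2 norm, and these squares, weighted by N^(-1), sum to
    the square of the Z norm: 48 = 4 * 12.  The sum over the scales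
    2^(-n), ..., 2^n is treated first, then Fatou takes care of the limit. *)
Theorem Z_variation v (s : nat -> R) m (M : R) :
  inZ chi (- 2^-1) v -> 0 <= M -> (Znorm chi (- 2^-1) v <= M%:E)%E ->
  (forall i, s i <= s i.+1) ->
  (\sum_(i < m) HQ (fun x => profile R v (s i.+1) x - profile R v (s i) x)%R
     <= (48 * M ^+ 2)%:E)%E.
Proof.
move=> [[vH _] vU _] M0 vM sm.
have mprof t : cmeasurable (profile R v t).
  by have [] := inH_Sgroup R _ (- t) _ (vH t Logic.I).
pose D i x := profile R v (s i.+1) x - profile R v (s i) x.
have mD i : cmeasurable (D i) by exact: cmeasurableB.
pose h0 x := \sum_(i < m) sqn R (D i x).
have h0_ge0 x : 0 <= h0 x by apply: sumr_ge0 => i _; exact: sqn_ge0.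
have mh0 : measurable_fun setT h0 by apply: measurable_sum => i; exact: cmeasurable_sqn.
pose weight n x := 4 * \sum_(j < n.*2.+1)
     (dyadic R (kindex n j))^-1 * psi ((dyadic R (kindex n j))^-1 * x) ^+ 2.
have weight_ge0 n x : 0 <= weight n x.
  by rewrite mulr_ge0 // sumr_ge0 // => j _; exact: block_weight_ge0.
have mweight n : measurable_fun setT (weight n).
  apply: measurable_funM => //; apply: measurable_sum => j; apply: measurable_funM => //.
  by apply: measurable_funX; exact: measurable_block_mult.
have mhw := measurable_hweight R (- 2^-1).
have -> : (\sum_(i < m) HQ (D i) = \int[mu]_x (hweight R (- 2^-1) x * h0 x)%:E)%E.
  rewrite /wnorm2 -(integral_sum_ge0 R m (fun i x => hweight R (- 2^-1) x * sqn R (D i x))).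
  - by apply: eq_integral => x _; rewrite -mulr_sumr.
  - by move=> i _; apply: measurable_funM => //; exact: cmeasurable_sqn.
  - by move=> i x; rewrite mulr_ge0 ?hweight_ge0 ?sqn_ge0.
have Zsq : (\esum_(k in [set: int])
    ((dyadic R k `^ (2 * - 2^-1))%:E * UpS_norm 2 (PN chi k v) `^ 2) <= (M ^+ 2)%:E)%E.
  set X := (\esum_(k in _) _)%E.
  have X0 : (0 <= X)%E.
    by apply: esum_ge0 => k _; rewrite mule_ge0 ?lee_fin ?powR_ge0 ?poweR_ge0.
  have -> : X = ((X `^ 2^-1) `^ 2)%E by rewrite -poweRrM mulVf // poweRe1.
  by rewrite poweR2_le ?poweR_ge0.
have block_le n : (\int[mu]_x (weight n x * h0 x)%:E <= (48 * M ^+ 2)%:E)%E.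
  have -> : (\int[mu]_x (weight n x * h0 x)%:E = 4%:E * \sum_(j < n.*2.+1)
      ((dyadic R (kindex n j))^-1%:E * \sum_(i < m) Q (block (kindex n j) (D i))))%E.
    pose G j x := \sum_(i < m) sqn R (block (kindex n j) (D i) x).
    have G0 j x : 0 <= G j x by apply: sumr_ge0 => i _; exact: sqn_ge0.
    have mG j : measurable_fun setT (G j).
      by apply: measurable_sum => i; apply: cmeasurable_sqn; exact: cmeasurable_block.
    have c0 j : 0 <= (dyadic R (kindex n j))^-1 by rewrite invr_ge0 ltW // dyadic_gt0.
    transitivity (\int[mu]_x (4%:E *
        (\sum_(j < n.*2.+1) (dyadic R (kindex n j))^-1 * G j x)%:E))%E.
      apply: eq_integral => x _; rewrite -EFinM; congr EFin.
      rewrite /weight -mulrA mulr_suml; congr (_ * _); apply: eq_bigr => j _.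
      rewrite -mulrA; congr (_ * _); rewrite mulr_sumr; apply: eq_bigr => i _.
      by rewrite block_sqn.
    rewrite ge0_integralZl //; last 2 first.
    - apply/measurable_EFinP; apply: measurable_sum => j.
      by apply: measurable_funM; [exact: measurable_cst|exact: mG].
    - by move=> x _; rewrite lee_fin sumr_ge0 // => j _; apply: mulr_ge0; [exact: c0|exact: G0].
    rewrite (integral_sum_ge0 R n.*2.+1 (fun j x => (dyadic R (kindex n j))^-1 * G j x));
      last 2 first.
    - by move=> j _; apply: measurable_funM; [exact: measurable_cst|exact: mG].
    - by move=> j x; apply: mulr_ge0; [exact: c0|exact: G0].
    congr (_ * _)%E; apply: eq_bigr => j _.
    under eq_integral do rewrite EFinM.
    rewrite ge0_integralZl //; last 3 first.
    - apply/measurable_EFinP; exact: mG.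
    - by move=> x _; rewrite lee_fin.
    - by rewrite lee_fin.
    rewrite (integral_sum_ge0 R m (fun i x => sqn R (block (kindex n j) (D i) x))).
    - congr (_ * _)%E; apply: eq_bigr => i _; apply: eq_integral => x _.
      by rewrite /= mul1r.
    - by move=> i _; apply: cmeasurable_sqn; exact: cmeasurable_block.
    - by move=> i x; exact: sqn_ge0.
  have -> : 48 * M ^+ 2 = 4 * (12 * M ^+ 2) by ring.
  rewrite EFinM lee_wpmul2l // EFinM.
  apply: (@le_trans _ _ (12%:E * \sum_(j < n.*2.+1) ((dyadic R (kindex n j) `^ (2 * - 2^-1))%:E
      * UpS_norm 2 (PN chi (kindex n j) v) `^ 2))%E); last first.
    rewrite lee_wpmul2l //; apply: le_trans Zsq.
    apply: (esum_ge_kindex (fun k => (dyadic R k `^ (2 * - 2^-1))%:E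
      * UpS_norm 2 (PN chi k v) `^ 2)%E) => k.
    by rewrite mule_ge0 ?lee_fin ?powR_ge0 ?poweR_ge0.
  rewrite ge0_sume_distrr; last first.
    by move=> j _; rewrite mule_ge0 ?lee_fin ?powR_ge0 ?poweR_ge0.
  apply: lee_sum => j _.
  rewrite mulrN mulfV // powR_inv1 ?(ltW (dyadic_gt0 _ _)) // muleCA.
  rewrite lee_wpmul2l ?lee_fin ?invr_ge0 ?(ltW (dyadic_gt0 _ _)) //.
  apply: le_trans (up_variation R _ s m (vU (kindex n j)) sm).
  by apply: lee_sum => i _; apply: block_increment; exact: vH.
have mwh n : measurable_fun setT (fun x => (weight n x * h0 x)%:E).
  by apply/measurable_EFinP; exact: measurable_funM.
apply: (@le_trans _ _ (\int[mu]_x limn_einf (fun n => (weight n x * h0 x)%:E))%E).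
  apply: ge0_le_integral => //.
  - by move=> x _; rewrite lee_fin mulr_ge0 ?hweight_ge0.
  - by apply/measurable_EFinP; exact: measurable_funM.
  - exact: measurable_fun_limn_einf.
  - move=> x _; apply: limn_einf_ge; have := LP_weight R chi hchi x.
    by apply: filterS => n wn; rewrite lee_fin ler_wpM2r.
apply: le_trans (fatou mu measurableT mwh _) _.
  by move=> n x _; rewrite lee_fin mulr_ge0.
by apply: limn_einf_le; apply: nearW.
Qed.

End ZVariation.

(** * Finite quadratic variation on a half-line *)

Section FiniteVariation.
Variable R : realType.

(** If this fails for e, then beyond every time there is a jump larger than e,
    and sufficiently many of them one after the other exceed the bound on the
    variation. *)
Lemma cauchy_of_bounded_variation (q : R -> R -> \bar R) (B : R) :
  (forall t t', 0 <= q t t')%E ->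
  (forall (s : nat -> R) m, 0 <= s 0%N -> (forall i, s i <= s i.+1) ->
    (\sum_(i < m) q (s i) (s i.+1) <= B%:E)%E) ->
  forall e : R, 0 < e -> exists2 T, 0 <= T &
    forall t t', T <= t -> t <= t' -> (q t t' <= e%:E)%E.
Proof.
move=> q0 qB e e0; apply: contrapT => noT.
have jump T : 0 <= T -> exists t t', [/\ T <= t, t <= t' & (e%:E < q t t')%E].
  move=> T0; apply: contrapT => nojump; apply: noT; exists T => // t t' Tt tt'.
  by rewrite leNgt; apply/negP => h; apply: nojump; exists t, t'.
have grow n : forall T, 0 <= T -> exists s m, [/\ T <= s 0%N,
    forall i, s i <= s i.+1 & ((n%:R * e)%:E <= \sum_(i < m) q (s i) (s i.+1))%E].
  elim: n => [|n IH] T T0.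
    by exists (fun=> T), 0%N; split => //; rewrite mul0r big_ord0.
  have [t [t' [Tt tt' et]]] := jump T T0.
  have [s [m [ts sm ns]]] := IH t' (le_trans T0 (le_trans Tt tt')).
  exists (fun i => if i is i'.+1 then if i' is i''.+1 then s i'' else t' else t), m.+2.
  split => //; first by case=> [|[|i]] //=.
  rewrite !big_ord_recl /= -natr1 mulrDl mul1r addrC EFinD.
  apply: leeD; first exact: ltW.
  by apply: (le_trans ns); rewrite leeDr.
have [s [m [s0 sm]]] := grow (Num.truncn (B / e)).+1 0 (lexx _).
move/le_trans => /(_ _ (qB s m s0 sm)); rewrite lee_fin -ler_pdivlMr // leNgt.
by rewrite truncnS_gt.
Qed.

End FiniteVariation.

(** * Completeness of weighted square integrable functions *)

Section Completeness.
Variable R : realType.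
Local Notation mu := (@lebesgue_measure R).

Lemma sum_geometric_le2 N : \sum_(n < N) (2 ^+ n)^-1 <= 2 :> R.
Proof.
suff -> : \sum_(n < N) (2 ^+ n)^-1 = 2 - 2 * (2 ^+ N)^-1 :> R.
  by rewrite lerBlDr lerDl mulr_ge0 // invr_ge0 exprn_ge0.
elim: N => [|N IH]; first by rewrite big_ord0 expr0 invr1; ring.
by rewrite big_ord_recr /= IH exprS invfM; field; rewrite expf_neq0.
Qed.

(** By 2|y| <= 2^(-n) + 2^n y^2 the increments are absolutely summable.  The
    weights let square summability replace summability. *)
Lemma cvg_of_weighted_increments (x : nat -> R) (S : R) :
  (forall N, \sum_(n < N) 2 ^+ n * (x n.+1 - x n) ^+ 2 <= S) -> cvgn x.
Proof.
move=> xS.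
have bound N : \sum_(n < N) `|x n.+1 - x n| <= 2^-1 * (2 + S).
  apply: (@le_trans _ _ (2^-1 * (\sum_(n < N) (2 ^+ n)^-1 +
      \sum_(n < N) 2 ^+ n * (x n.+1 - x n) ^+ 2))); last first.
    by rewrite ler_wpM2l ?invr_ge0 // lerD // sum_geometric_le2.
  rewrite -big_split mulr_sumr; apply: ler_sum => n _ /=.
  rewrite -(real_normK (num_real (x n.+1 - x n))).
  have p0 : 0 < 2 ^+ n :> R by rewrite exprn_gt0.
  move: `|_| (2 ^+ n) p0 => y p p0.
  have ip0 : 0 < p^-1 by rewrite invr_gt0.
  have pp : p * p^-1 = 1 by rewrite mulfV // gt_eqF.
  have := mulr_ge0 (ltW ip0) (sqr_ge0 (p * y - 1)).
  rewrite (_ : p^-1 * (p * y - 1) ^+ 2 = p * y ^+ 2 - 2 * y + p^-1); first lra.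
  by field; rewrite gt_eqF.
have cs : cvgn (series (telescope x)).
  apply: normed_cvg; apply: nondecreasing_is_cvgn.
    apply/nondecreasing_seqP => n; rewrite /= /series /= big_nat_recr //= lerDl //.
  exists (2^-1 * (2 + S)) => _ [N _ <-].
  have -> : [normed series (telescope x)] N = \sum_(n < N) `|x n.+1 - x n|.
    by rewrite -(big_mkord xpredT (fun n => `|x n.+1 - x n|)).
  exact: bound.
have -> : x = (fun n => x 0%N + series (telescope x) n).
  by apply/funext => n; exact: eq_sum_telescope.
by apply: is_cvgD => //; exact: is_cvg_cst.
Qed.

Lemma wnorm2_sub_sym w (f g : R -> R[i]) :
  wnorm2 R w (fun x => f x - g x)%R = wnorm2 R w (fun x => g x - f x)%R.
Proof.
by apply: eq_integral => x _; rewrite -(sqnN R (f x - g x)) opprB.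
Qed.

Lemma cvg_sqn (z : R[i]) (z_ : nat -> R[i]) (p q : R) :
  complex.Re (z_ n) @[n --> \oo] --> p -> complex.Im (z_ n) @[n --> \oo] --> q ->
  sqn R (z - z_ n) @[n --> \oo] --> sqn R (z - (p +i* q)).
Proof.
move=> cp cq.
rewrite (_ : (fun n => _) = (fun n => (complex.Re z - complex.Re (z_ n)) ^+ 2
   + (complex.Im z - complex.Im (z_ n)) ^+ 2)); last first.
  by apply/funext => n; case: z => a b; case: (z_ n).
rewrite (_ : sqn R _ = (complex.Re z - p) ^+ 2 + (complex.Im z - q) ^+ 2); last by case: z.
by apply: cvgD; rewrite !expr2; under eq_fun do rewrite expr2; apply: cvgM;
  apply: cvgB => //; exact: cvg_cst.
Qed.

Variable w : R -> R.
Hypothesis mw : measurable_fun setT w.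
Hypothesis w0 : forall x, 0 <= w x.
Hypothesis w_gt0 : {ae mu, forall x, 0 < w x}.

(** Multiplied by 2^n, the squared distances of consecutive terms are still
    summable, so for almost every x the series of 2^n |F_(n+1)(x) - F_n(x)|^2
    converges, and with it F_n(x). *)
Lemma rapid_cauchy_cvg (F : nat -> R -> R[i]) : (forall n, cmeasurable (F n)) ->
  (forall n, (wnorm2 R w (fun x => F n.+1 x - F n x)%R <= ((2 ^+ n * 2 ^+ n)^-1)%:E)%E) ->
  exists2 f, cmeasurable f & {ae mu, forall x,
    complex.Re (F n x) @[n --> \oo] --> complex.Re (f x) /\
    complex.Im (F n x) @[n --> \oo] --> complex.Im (f x)}.
Proof.
move=> mF dF.
pose G n x := (2 ^+ n * (w x * sqn R (F n.+1 x - F n x)))%:E.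
have G0 n x : (0 <= G n x)%E by rewrite lee_fin !mulr_ge0 ?sqn_ge0 ?exprn_ge0.
have mG n : measurable_fun setT (G n).
  apply/measurable_EFinP; apply: measurable_funM => //; apply: measurable_funM => //.
  by apply: cmeasurable_sqn; exact: cmeasurableB.
have intG n : (\int[mu]_x G n x <= ((2 ^+ n)^-1)%:E)%E.
  have p0 : 0 < 2 ^+ n :> R by rewrite exprn_gt0.
  rewrite (_ : (2 ^+ n)^-1 = 2 ^+ n * (2 ^+ n * 2 ^+ n)^-1); last by field; rewrite gt_eqF.
  rewrite EFinM; apply: le_trans (lee_wpmul2l _ (dF n)); last by rewrite lee_fin ltW.
  rewrite /wnorm2 -ge0_integralZl //.
  - by apply: measurable_wsqn => //; exact: cmeasurableB.
  - by move=> x _; rewrite lee_fin mulr_ge0 ?sqn_ge0.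
have iG : mu.-integrable setT (fun x => \sum_(0 <= n <oo) G n x)%E.
  apply/integrableP; split; first by apply: ge0_emeasurable_sum => *; [exact: G0|exact: mG].
  under eq_integral => x _ do rewrite gee0_abs ?nneseries_ge0 //.
  rewrite integral_nneseries //; apply: (@le_lt_trans _ _ 2%:E); last exact: ltry.
  apply: lime_le.
    by apply: is_cvg_nneseries => n _ _; exact: integral_ge0.
  apply: nearW => N; rewrite big_mkord.
  apply: (@le_trans _ _ (\sum_(n < N) ((2 ^+ n)^-1)%:E)%E); first exact: lee_sum.
  by rewrite sumEFin lee_fin sum_geometric_le2.
(* upper limits exist everywhere, which makes f measurable *)
pose f x := fine (limn_esup (fun n => (complex.Re (F n x))%:E)) +i*
            fine (limn_esup (fun n => (complex.Im (F n x))%:E)).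
exists f.
  by split; apply: (@measurableT_comp _ _ _ _ _ _ fine);
    [exact: fine_measurable|apply: measurable_fun_limn_esup => n; apply/measurable_EFinP;
     have [] := mF n|exact: fine_measurable|apply: measurable_fun_limn_esup => n;
     apply/measurable_EFinP; have [] := mF n].
have := integrable_ae measurableT iG.
apply: (@filterS2 _ _ (ae_filter_ringOfSetsType mu) _ _ _ _ w_gt0) => x wx /(_ Logic.I) finG.
have [S Sx] : exists S, forall N, \sum_(n < N) 2 ^+ n * sqn R (F n.+1 x - F n x) <= S.
  exists ((w x)^-1 * fine (\sum_(0 <= n <oo) G n x)%E) => N.
  rewrite mulrC ler_pdivlMr // -lee_fin fineK // mulr_suml -sumEFin.
  apply: le_trans (nneseries_lim_ge N _); last by move=> n _ _; exact: G0.
  by rewrite big_mkord; apply: lee_sum => n _; rewrite lee_fin mulrAC mulrA.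
have to_limit (h : R[i] -> R) :
    (forall n, (h (F n.+1 x) - h (F n x)) ^+ 2 <= sqn R (F n.+1 x - F n x)) ->
    h (F n x) @[n --> \oo] --> fine (limn_esup (fun n => (h (F n x))%:E)).
  move=> hF; have ch : cvgn (fun n => h (F n x)).
    apply: (cvg_of_weighted_increments _ S) => N; apply: le_trans (Sx N).
    by apply: ler_sum => n _; rewrite ler_wpM2l // exprn_ge0.
  have c2 : (h (F n x))%:E @[n --> \oo] --> (limn (fun n => h (F n x)))%:E.
    by apply: cvg_EFin; [exact: nearW|exact: ch].
  by have [_ ->] := cvg_limn_einf_sup c2.
split; apply: to_limit => n.
  by case: (F n.+1 x) => a b; case: (F n x) => c d; rewrite /sqn /= lerDl sqr_ge0.
by case: (F n.+1 x) => a b; case: (F n x) => c d; rewrite /sqn /= lerDr sqr_ge0.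
Qed.

End Completeness.

Section LimitAtInfinity.
Variable R : realType.
Local Notation mu := (@lebesgue_measure R).
Variable w : R -> R.
Hypothesis mw : measurable_fun setT w.
Hypothesis w0 : forall x, 0 <= w x.
Hypothesis w_gt0 : {ae mu, forall x, 0 < w x}.

(** Along a sequence of times with rapidly decreasing increments there is a
    pointwise limit almost everywhere; by Fatou the distance to that limit
    inherits the Cauchy bound. *)
Lemma limit_at_infinity (F : R -> R -> R[i]) : (forall t, cmeasurable (F t)) ->
  (forall e : R, 0 < e -> exists2 T, 0 <= T & forall t t', T <= t -> t <= t' ->
    (wnorm2 R w (fun x => F t' x - F t x)%R <= e%:E)%E) ->
  exists2 f, cmeasurable f & forall e : R, 0 < e -> exists2 T, 0 <= T & forall t, T <= t ->
    (wnorm2 R w (fun x => F t x - f x)%R <= e%:E)%E.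
Proof.
move=> mF cF.
have pos n : 0 < (2 ^+ n * 2 ^+ n)^-1 :> R by rewrite invr_gt0 mulr_gt0 // exprn_gt0.
have ex_T n : exists T, 0 <= T /\ forall t t', T <= t -> t <= t' ->
    (wnorm2 R w (fun x => F t' x - F t x)%R <= ((2 ^+ n * 2 ^+ n)^-1)%:E)%E.
  by have [T T0 hT] := cF _ (pos n); exists T.
have [T_ T_P] := choice ex_T.
have T_0 n : 0 <= T_ n by have [] := T_P n.
(* times that are increasing, beyond T_n, and unbounded *)
pose t n := \sum_(j < n.+1) (T_ j + 1).
have tS n : t n.+1 = t n + (T_ n.+1 + 1) by rewrite /t big_ord_recr.
have t_le n : t n <= t n.+1 by rewrite tS lerDl addr_ge0.
have t_ge n : T_ n <= t n.
  by rewrite /t big_ord_recr /= addrCA lerDl addr_ge0 // sumr_ge0 // => j _; rewrite addr_ge0.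
have t_gt n : n%:R <= t n.
  elim: n => [|n IH]; first exact: le_trans (t_ge 0%N).
  by rewrite tS -natr1 lerD // lerDr.
have [|f mf Ff] := rapid_cauchy_cvg R w mw w0 w_gt0 (F \o t) (fun n => mF (t n)).
  by move=> n; have [_] := T_P n; apply.
exists f => // e e0; have [T T0 hT] := cF e e0; exists T => // r Tr.
pose g n x := (w x * sqn R (F r x - F (t n) x))%:E.
have mg n : measurable_fun setT (g n) by apply: measurable_wsqn => //; exact: cmeasurableB.
have g0 n x : (0 <= g n x)%E by rewrite lee_fin mulr_ge0 ?sqn_ge0.
apply: (@le_trans _ _ (\int[mu]_x limn_einf (g^~ x))%E).
  apply: ae_ge0_le_integral => //.
  - by move=> x _; rewrite lee_fin mulr_ge0 ?sqn_ge0.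
  - by apply: measurable_wsqn => //; exact: cmeasurableB.
  - by move=> x _; apply: limn_einf_ge; exact: nearW.
  - exact: measurable_fun_limn_einf.
  apply: (@filterS _ _ (ae_filter_ringOfSetsType mu)) Ff => x [cRe cIm] _.
  have c1 : g n x @[n --> \oo] --> (w x * sqn R (F r x - f x))%:E.
    apply: cvg_EFin; first exact: nearW.
    apply: cvgMr; rewrite [f x](_ : _ = complex.Re (f x) +i* complex.Im (f x)).
      exact: cvg_sqn.
    by case: (f x).
  by have [-> _] := cvg_limn_einf_sup c1.
apply: le_trans (fatou mu measurableT mg (fun n x _ => g0 n x)) _.
apply: limn_einf_le; near=> n.
have rt : r <= t n.
  by apply: le_trans (t_gt n); near: n; exact: nbhs_infty_ger.
by rewrite /g -/(wnorm2 R w (fun x => F r x - F (t n) x)) wnorm2_sub_sym; exact: hT.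
Unshelve. all: by end_near. Qed.

End LimitAtInfinity.

(** * Scattering *)

Section Scattering.
Variable R : realType.
Local Notation mu := (@lebesgue_measure R).
Local Notation HQ := (wnorm2 R (hweight R (- 2^-1))).

Lemma hweight_gt0 : {ae mu, forall x, 0 < hweight R (- 2^-1) x}.
Proof.
exists [set 0]; split; [exact: measurable_set1|exact: lebesgue_measure_set1|].
move=> x; apply: contra_notP => /eqP x0.
by rewrite /= hweight_half // invr_gt0 normr_gt0.
Qed.

Lemma Hnorm_le s (g : R -> R[i]) (e : R) : 0 <= e ->
  (Hnorm s g <= e%:E)%E = (wnorm2 R (hweight R s) g <= (e ^+ 2)%:E)%E.
Proof. by move=> e0; rewrite -Hnorm_sqr poweR2_le // Hnorm_ge0. Qed.

Lemma inHE s (g : R -> R[i]) : cmeasurable g ->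
  (wnorm2 R (hweight R s) g < +oo)%E -> inH s g.
Proof.
move=> mg; rewrite -Hnorm_sqr => h; split => //.
by apply: lty_poweRy h; rewrite pnatr_eq0.
Qed.

Lemma ge0_cvg0P (T : Type) (F : set_system T) (FF : Filter F) (f : T -> \bar R) :
  (forall x, 0 <= f x)%E -> (forall e : R, 0 < e -> \forall x \near F, (f x <= e%:E)%E) ->
  (f @ F --> 0)%E.
Proof.
move=> f0 fe; apply/fine_cvgP; split.
  have := fe 1 ltr01; apply: filterS => x f1.
  by rewrite ge0_fin_numE // (le_lt_trans f1) // ltry.
apply/cvgr0Pnorm_le => e e0; have := fe e e0; apply: filterS => x /= fx.
have fin : f x \is a fin_num by rewrite ge0_fin_numE // (le_lt_trans fx) // ltry.
by rewrite ger0_norm ?fine_ge0 // -lee_fin fineK.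
Qed.

(** The profile has a limit f at infinity, and by unitarity the distance from
    u(t) to S(t) f is the distance from the profile to f. *)
Lemma scatters_of_variation (u : R -> R -> R[i]) (B : R) :
  (forall t, 0 <= t -> inH (- 2^-1) (u t)) ->
  (forall (s : nat -> R) m, 0 <= s 0%N -> (forall i, s i <= s i.+1) ->
    (\sum_(i < m) HQ (fun x => profile R u (s i.+1) x - profile R u (s i) x)%R <= B%:E)%E) ->
  scatters (- 2^-1) u.
Proof.
move=> uH uB.
(* extended to negative times by its value at 0 *)
pose F t := profile R u (Num.max 0 t).
have FH t : inH (- 2^-1) (F t) by apply: inH_Sgroup; apply: uH; rewrite le_max lexx.
have F_E t : 0 <= t -> F t = profile R u t by move=> t0; rewrite /F max_r.
have mF t : cmeasurable (F t) by have [] := FH t.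
have w0 := hweight_ge0 R (- 2^-1).
have cF := cauchy_of_bounded_variation R
  (fun t t' => HQ (fun x => F t' x - F t x)%R) B (fun t t' => wnorm2_ge0 R _ _ w0).
have [|f mf Ff] := limit_at_infinity R _ (measurable_hweight R (- 2^-1)) w0 hweight_gt0 F mF.
  apply: cF => s m s0 sm.
  have s_ge0 i : 0 <= s i by elim: i => [//|i IH]; exact: le_trans (sm i).
  by under eq_bigr do rewrite !F_E //; exact: uB.
have fH : inH (- 2^-1) f.
  apply: inHE => //; have [T T0 hT] := Ff 1 ltr01.
  have -> : f = fun x => F T x + 0 - (F T x - f x).
    by apply/funext => x; ring.
  apply: le_lt_trans (wnorm2D3 R _ (F T) (cst 0) (fun x => F T x - f x)
    (measurable_hweight R _) w0 (mF T) (cmeasurable_cst _ _) (cmeasurableB _ _ _ (mF T) mf)) _.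
  have Q0 : HQ (cst 0) = 0%E.
    by rewrite /wnorm2 integral0_eq // => x _; rewrite /sqn /= expr0n addr0 mulr0.
  apply: lte_mul_pinfty => //; rewrite Q0 adde0 lte_add_pinfty //.
    exact: inH_HQ.
  by rewrite (le_lt_trans (hT _ (lexx _))) // ltry.
exists f; split => //.
apply: ge0_cvg0P => [t|e e0]; first exact: Hnorm_ge0.
have [T T0 hT] := Ff (e ^+ 2) (exprn_gt0 2 e0).
exists T; split; first exact: num_real.
move=> t /ltW Tt; have t0 : 0 <= t := le_trans T0 Tt.
rewrite (_ : _ \- _ = Sgroup t (fun x => F t x - f x)).
  by rewrite Hnorm_Sgroup Hnorm_le ?(ltW e0) // hT.
by rewrite SgroupB F_E // /profile SgroupK.
Qed.

End Scattering.

(** * Invariance under almost everywhere equality and under restriction *)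

Section AlmostEverywhereInvariance.
Variable R : realType.
Local Notation mu := (@lebesgue_measure R).

Lemma Heq_sym (g h : R -> R[i]) : Heq g h -> Heq h g.
Proof. by apply: (@filterS _ _ (ae_filter_ringOfSetsType mu)) => x ->. Qed.

Lemma Heq_trans (f g h : R -> R[i]) : Heq f g -> Heq g h -> Heq f h.
Proof. by apply: (@filterS2 _ _ (ae_filter_ringOfSetsType mu)) => x -> ->. Qed.

Lemma wnorm2_Heq (w : R -> R) (g h : R -> R[i]) : measurable_fun setT w -> (forall x, 0 <= w x) ->
  cmeasurable g -> cmeasurable h -> Heq g h -> wnorm2 R w g = wnorm2 R w h.
Proof.
move=> mw w0 mg mh gh; apply: ge0_ae_eq_integral => //.
- exact: measurable_wsqn.
- exact: measurable_wsqn.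
- by move=> x _; rewrite lee_fin mulr_ge0 ?sqn_ge0.
- by move=> x _; rewrite lee_fin mulr_ge0 ?sqn_ge0.
- by apply: (@filterS _ _ (ae_filter_ringOfSetsType mu)) gh => x -> _.
Qed.

Lemma Hnorm_Heq s (g h : R -> R[i]) : cmeasurable g -> cmeasurable h -> Heq g h ->
  Hnorm s g = Hnorm s h.
Proof.
move=> mg mh gh.
have E (k : R -> R[i]) : Hnorm s k = ((Hnorm s k `^ 2) `^ 2^-1)%E.
  by rewrite -poweRrM mulfV // poweRe1 // Hnorm_ge0.
rewrite E (E h) !Hnorm_sqr; congr (_ `^ _)%E; apply: wnorm2_Heq => //.
  exact: measurable_hweight.
exact: hweight_ge0.
Qed.

Lemma Heq_sub (g g' h h' : R -> R[i]) : Heq g g' -> Heq h h' -> Heq (g \- h) (g' \- h').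
Proof. by apply: (@filterS2 _ _ (ae_filter_ringOfSetsType mu)) => x /= -> ->. Qed.

Lemma Heq_profile_sub (u v : R -> R -> R[i]) t t' : Heq (u t) (v t) -> Heq (u t') (v t') ->
  Heq (fun x => profile R u t x - profile R u t' x) (fun x => profile R v t x - profile R v t' x).
Proof.
by apply: (@filterS2 _ _ (ae_filter_ringOfSetsType mu)) => x e e'; rewrite /profile /Sgroup e e'.
Qed.

Lemma schwartz_cmeasurable (th : R -> R[i]) : schwartz th -> cmeasurable th.
Proof.
have rs (f : R -> R) : rschwartz f -> measurable_fun setT f.
  move=> [sf _]; apply: continuous_measurable_fun.
  by apply: derivable_continuous => x; exact: (sf 0%N).
by move=> [h1 h2]; split; exact: rs.
Qed.

Lemma pairing_Heq (g h th : R -> R[i]) : cmeasurable g -> cmeasurable h -> schwartz th ->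
  Heq g h -> pairing g th = pairing h th.
Proof.
move=> mg mh /schwartz_cmeasurable mth gh.
have [g1 g2] := cmeasurableM R _ _ mg mth; have [h1 h2] := cmeasurableM R _ _ mh mth.
rewrite /pairing /cint; congr (_ +i* _); congr fine.
  apply: ae_eq_integral => //; [exact/measurable_EFinP|exact/measurable_EFinP|].
  by apply: (@filterS _ _ (ae_filter_ringOfSetsType mu)) gh => x -> _.
apply: ae_eq_integral => //; [exact/measurable_EFinP|exact/measurable_EFinP|].
by apply: (@filterS _ _ (ae_filter_ringOfSetsType mu)) gh => x -> _.
Qed.

(** The same space-time function w represents both solutions, and the values of
    a solution enter only through pairings. *)
Lemma solution_upto_Heq (T : R) (u0 : R -> R[i]) (u v : R -> R -> R[i]) :
  (forall t, 0 <= t <= T -> cmeasurable (u t)) ->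
  (forall t, 0 <= t <= T -> cmeasurable (v t)) ->
  (forall t, 0 <= t <= T -> Heq (u t) (v t)) ->
  solution_upto T u0 u -> solution_upto T u0 v.
Proof.
move=> mu_ mv uv [w [[w1 w2 w3 w4] wE]]; exists w; split; last first.
  move=> t tT th sth; rewrite -wE //; apply: pairing_Heq => //; [exact: mv|exact: mu_|].
  by apply: Heq_sym; exact: uv.
split => //; apply: (@filterS _ _ (ae_filter_ringOfSetsType mu)) w4 => t rt tT th sth.
have tT' : 0 <= t <= T by have /andP[t0 t1] := tT; rewrite !ltW.
by rewrite rt //; apply: pairing_Heq => //; [exact: mu_|exact: mv|exact: uv].
Qed.

Variable chi : R -> R.

Lemma Zextension_sub s (I J : set R) (u v : R -> R -> R[i]) : J `<=` I ->
  Zextension chi s I u v -> Zextension chi s J u v.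
Proof. by move=> JI [Zv uv]; split => // t /JI; exact: uv. Qed.

Lemma inZball_sub s (r : R) (I J : set R) (u : R -> R -> R[i]) : J `<=` I ->
  inZball chi s r I u -> inZball chi s r J u.
Proof.
move=> JI [[uH [v uv]] ur]; split.
  by split; [move=> t /JI; exact: uH|exists v; exact: Zextension_sub uv].
apply: le_trans ur; apply: ereal_inf_le_tmp => _ [v' uv' <-].
by exists v' => //; exact: Zextension_sub uv'.
Qed.

Lemma solution_sub (T T' : \bar R) (u0 : R -> R[i]) u : (T' <= T)%E ->
  solution T u0 u -> solution T' u0 u.
Proof. by move=> TT' us S S0 ST; apply: us => //; exact: lt_le_trans TT'. Qed.

End AlmostEverywhereInvariance.

(** * Gluing the local solutions *)

Theorem corollary1p3 (R : realType) (chi : R -> R) (hchi : LPcutoff chi)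
    (r : R) (hr : 0 < r) (hwp : wellposed_radius chi (- 2^-1) r) :
  forall u0 : R -> R[i], Hball (- 2^-1) r u0 ->
    exists u : R -> R -> R[i],
      [/\ Hcontinuous (- 2^-1) `[0, +oo[ u,
          solution +oo%E u0 u &
          scatters (- 2^-1) u].
Proof.
move=> u0 u0r.
have exU n : exists u, inZball chi (- 2^-1) r `[0, n.+1%:R[ u /\ solution n.+1%:R%:E u0 u.
  by have [ex _ _] := hwp n.+1%:R (ltr0Sn _ n); exact: ex.
have [U UP] := choice exU.
have agree n m t : (n <= m)%N -> 0 <= t < n.+1%:R -> Heq (U n t) (U m t).
  move=> nm tn; have [_ uniq _] := hwp n.+1%:R (ltr0Sn _ n).
  have [Un sn] := UP n; have [Um sm] := UP m.
  apply: (uniq u0) => //.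
    apply: inZball_sub Um => x; rewrite /= !in_itv/= => /andP[-> xn].
    by rewrite (lt_le_trans xn) // ler_nat.
  by apply: solution_sub sm; rewrite lee_fin ler_nat.
pose u t := U (Num.truncn t) t.
have t_lt (t : R) : 0 <= t -> t < (Num.truncn t).+1%:R.
  by move=> _; exact: truncnS_gt.
have uE n t : 0 <= t < n.+1%:R -> Heq (u t) (U n t).
  move=> /andP[t0 tn]; apply: agree; last by rewrite t0 t_lt.
  by rewrite -ltnS -(ltr_nat R) (le_lt_trans _ tn) // truncn_le.
have UH n t : 0 <= t < n.+1%:R -> inH (- 2^-1) (U n t).
  by move=> tn; have [[[h _] _] _] := UP n; apply: h; rewrite /= in_itv.
have uH t : 0 <= t -> inH (- 2^-1) (u t).
  by move=> t0; apply: UH; rewrite t0 t_lt.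
(* 2r < 3r leaves room to realise the infimum in the norm on an interval *)
have ext n : exists v, [/\ inZ chi (- 2^-1) v, (Znorm chi (- 2^-1) v <= (3 * r)%:E)%E &
    forall t, 0 <= t < n.+1%:R -> Heq (v t) (u t)].
  have [[_ Un] _] := UP n.
  have /ereal_inf_lt[_ [v [Zv vE] <-] vr] :
      (Znorm_on chi (- 2^-1) `[0%R, n.+1%:R[ (U n) < (3 * r)%:E)%E.
    by apply: le_lt_trans Un _; rewrite lte_fin ltr_pM2r // ltr_nat.
  exists v; split => //; first exact: ltW.
  move=> t tn; apply: (Heq_trans _ _ (U n t)); first by apply: vE; rewrite /= in_itv.
  by apply: Heq_sym; exact: uE.
have mu_ t : 0 <= t -> cmeasurable (u t) by move=> /uH[].
exists u; split.
- split; first by move=> t; rewrite /= in_itv/= andbT; exact: uH.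
  move=> t0; rewrite /= in_itv/= andbT => t00.
  have [v [[[vH vc] _ _] _ vu]] := ext (Num.truncn t0).
  apply: (ge0_cvg0P R _ _ _) => [t|e e0]; first exact: Hnorm_ge0.
  have v_near : \forall t \near t0, (Hnorm (- 2^-1) (v t \- v t0)%R < e%:E)%E.
    have := cvg0_near_lt R _ _ _ _ e e0 (vc t0 Logic.I); rewrite near_withinE => h.
    near=> t; suff : setT t -> (Hnorm (- 2^-1) (v t \- v t0)%R < e%:E)%E by apply.
    by near: t; exact: h.
  have t_near : \forall t \near t0, t < (Num.truncn t0).+1%:R.
    by have := @cvg_id _ (nbhs t0); move=> /cvgr_lt; apply; exact: t_lt.
  rewrite near_withinE; near=> t; rewrite /= in_itv/= andbT => t_ge0.
  have tn : 0 <= t < (Num.truncn t0).+1%:R by rewrite t_ge0; near: t.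
  rewrite (Hnorm_Heq R _ _ (v t \- v t0)).
  + by apply: ltW; near: t.
  + by apply: cmeasurableB; exact: mu_.
  + by apply: cmeasurableB; have [] := vH t Logic.I; have [] := vH t0 Logic.I.
  + by apply: Heq_sub; apply: Heq_sym; apply: vu => //; rewrite t00 t_lt.
- move=> T T0 _; have [_ sol] := UP (Num.truncn T).
  have TT : T < (Num.truncn T).+1%:R by apply: t_lt; exact: ltW.
  have small t : 0 <= t <= T -> 0 <= t < (Num.truncn T).+1%:R.
    by move=> /andP[-> tT]; exact: le_lt_trans TT.
  apply: (solution_upto_Heq R T u0 (U (Num.truncn T)) u).
  + by move=> t /small tT; have [] := UH _ _ tT.
  + by move=> t /andP[t0 _]; exact: mu_.
  + by move=> t /small tT; apply: Heq_sym; exact: uE.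
  + by apply: sol => //; rewrite lte_fin.
- apply: (scatters_of_variation R u (48 * (3 * r) ^+ 2)) => // s m s0 sm.
  have s_ge0 i : 0 <= s i by elim: i => [//|i IH]; exact: le_trans (sm i).
  have s_mono i j : (i <= j)%N -> s i <= s j.
    by move=> ij; apply: (homo_leq (r := fun a b => a <= b)) => //; exact: le_trans.
  have [v [Zv vr vu]] := ext (Num.truncn (s m)).
  have sv i : (i <= m)%N -> Heq (v (s i)) (u (s i)).
    by move=> im; apply: vu; rewrite s_ge0 (le_lt_trans (s_mono _ _ im)) // t_lt.
  have r0 : 0 <= 3 * r by rewrite mulr_ge0 // ltW.
  apply: le_trans (Z_variation R chi hchi v s m (3 * r) Zv r0 vr sm).
  apply: lee_sum => i _; rewrite le_eqVlt; apply/orP; left; apply/eqP.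
  have mp (z : R -> R -> R[i]) t : cmeasurable (z t) -> cmeasurable (profile R z t).
    exact: cmeasurable_Sgroup.
  have [[vH _] _ _] := Zv.
  apply: wnorm2_Heq; [exact: measurable_hweight|exact: hweight_ge0| | |].
  + by apply: cmeasurableB; apply: mp; exact: mu_.
  + by apply: cmeasurableB; apply: mp; have [] := vH (s i.+1) Logic.I; have [] := vH (s i) Logic.I.
  + by apply: Heq_profile_sub; apply: Heq_sym; apply: sv => //; exact: ltnW.
Unshelve. all: by end_near. Qed.
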